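(* There exists an indexed family of languages $\mathscr{L}$ that is identified by some HCEGIS engine but by no CEGIS engine; i.e. $\mathtt{HCEGIS}\not\subseteq\mathtt{CEGIS}$.
   Context: Languages are subsets of $\mathbb{N}$, ordered by the natural order of $\mathbb{N}$; $\overline{L}=\mathbb{N}\setminus L$. An indexed family of languages is a sequence $\mathscr{L}=L_0,L_1,\ldots$ of non-empty recursive languages for which there is a total recursive function $\mathtt{TEMPLATE}$ with $\mathtt{TEMPLATE}(i,n)=1$ if $n\in L_i$ and $0$ otherwise; the program $P_i$ is $n\mapsto\mathtt{TEMPLATE}(i,n)$, $\mathscr{P}=\{P_0,P_1,\ldots\}$, and $L(P_i)=L_i$. A sequence is a map $\sigma:\mathbb{N}\to\mathbb{N}\cup\{\bot\}$; $\sigma[k]$ is its prefix of length $k$, $\sigma(k)$ its $k$-th element, $\sigma_0$ the empty sequence, $\mathtt{SMPL}(\sigma)=\mathrm{range}(\sigma)\setminus\{\bot\}$. A trace for $L$ is a sequence $\tau$ with $\mathtt{SMPL}(\tau)=L$. A verifier $\mathtt{CHECK}_L$ is a (non-deterministic) map from $\mathscr{L}$ to $\mathbb{N}\cup\{\bot\}$ with $\mathtt{CHECK}_L(L_i)=\bot$ iff $L_i\subseteq L$ and otherwise $\mathtt{CHECK}_L(L_i)\in L_i\cap\overline{L}$. A history-bounded verifier $\mathtt{HCHECK}_L$ maps $L_i\in\mathscr{L}$ and a trace prefix $\tau[n]$ to $\mathbb{N}\cup\{\bot\}$: $\mathtt{HCHECK}_L(L_i,\tau[n])=m$ for some $m\in\overline{L}\cap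 L_i$ with $m<\tau(j)$ for some $j\le n$, if such $m$ exists, and $\bot$ otherwise. A CEGIS engine is given by a recursive $F:\mathscr{P}\times\mathbb{N}\times\mathbb{N}\to\mathscr{P}$ (counterexample argument may be $\bot$) and initial program $P_0$: $T(\sigma_0,\sigma_0)=P_0$, $T(\tau[n],\mathtt{cex}[n])=F(T(\tau[n-1],\mathtt{cex}[n-1]),\tau(n),\mathtt{cex}(n))$, where $\tau$ is a trace of the target language $L$ and $\mathtt{cex}(i)=\mathtt{CHECK}_L(L(T(\tau[i-1],\mathtt{cex}[i-1])))$. An HCEGIS engine is defined identically but with $\mathtt{cex}(i)=\mathtt{HCHECK}_L(L(T(\tau[i-1],\mathtt{cex}[i-1])),\tau[i-1])$. $T$ converges to $P_i$ on $(\tau,\mathtt{cex})$ if $T(\tau[n],\mathtt{cex}[n])=P_i$ for all sufficiently large $n$; $T$ identifies $L_i$ if it converges to $P_i$ for every trace $\tau$ of $L_i$ and every corresponding counterexample sequence; $T$ identifies $\mathscr{L}$ if it identifies every member. $\mathtt{CEGIS}$ (resp. $\mathtt{HCEGIS}$) is the class of indexed families identified by some CEGIS (resp. HCEGIS) engine. *)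

(* Defs.v *)
From Stdlib Require Import List Arith.
Import ListNotations.

Inductive code : Type :=
| CZero : code
| CSucc : code
| CProj : nat -> code
| CComp : code -> list code -> code
| CPrec : code -> code -> code
| CMu   : code -> code.

Inductive eval : code -> list nat -> nat -> Prop :=
| ev_zero v : eval CZero v 0
| ev_succ x v : eval CSucc (x :: v) (S x)
| ev_proj i v : i < length v -> eval (CProj i) v (nth i v 0)
| ev_comp f gs v ws y : evals gs v ws -> eval f ws y -> eval (CComp f gs) v y
| ev_prec0 f g v y : eval f v y -> eval (CPrec f g) (0 :: v) y
| ev_precS f g n v y z :
    eval (CPrec f g) (n :: v) y -> eval g (n :: y :: v) z ->
    eval (CPrec f g) (S n :: v) z
| ev_mu f v n :
    eval f (n :: v) 0 ->
    (forall m, m < n -> exists k, eval f (m :: v) (S k)) ->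
    eval (CMu f) v n
with evals : list code -> list nat -> list nat -> Prop :=
| evs_nil v : evals [] v []
| evs_cons g gs v w ws : eval g v w -> evals gs v ws -> evals (g :: gs) v (w :: ws).

Definition recursive2 (f : nat -> nat -> nat) : Prop :=
  exists c : code, forall x y, eval c [x; y] (f x y).

Definition recursive3 (f : nat -> nat -> nat -> nat) : Prop :=
  exists c : code, forall x y z, eval c [x; y; z] (f x y z).

Definition enc (o : option nat) : nat :=
  match o with None => 0 | Some n => S n end.

(* A language is a (decidable) subset of N, given by its characteristic function. *)
Definition lang := nat -> bool.

(* L : nat -> lang is the family L_0, L_1, ...; program P_i is the index i. *)
Definition TEMPLATE (L : nat -> lang) (i n : nat) : nat := if L i n then 1 else 0.

Definition indexed_family (L : nat -> lang) : Prop :=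
  (forall i, exists n, L i n = true) /\ recursive2 (TEMPLATE L).

(* sequences σ : N -> N ∪ {⊥}; a trace for language M has SMPL(τ) = M *)
Definition is_trace (M : lang) (tau : nat -> option nat) : Prop :=
  forall n, M n = true <-> exists k, tau k = Some n.

(* ---------- Verifiers (as relations: the verifier is non-deterministic) ---------- *)

Definition check_ok (Lt Lh : lang) (c : option nat) : Prop :=
  match c with
  | None => forall m, Lh m = true -> Lt m = true
  | Some m => Lh m = true /\ Lt m = false
  end.

(* c is a legal answer of HCHECK_Lt on hypothesis Lh with history
   τ(0), ..., τ(n-1) (the examples already consumed) *)
Definition hcheck_ok (Lt Lh : lang) (tau : nat -> option nat) (n : nat)
    (c : option nat) : Prop :=
  match c with
  | None => ~ (exists m j t, j < n /\ tau j = Some t /\ m < t /\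
                             Lh m = true /\ Lt m = false)
  | Some m => Lh m = true /\ Lt m = false /\
              exists j t, j < n /\ tau j = Some t /\ m < t
  end.

(* hypothesis (program index) after consuming τ(0..n-1) and cex(0..n-1);
   h 0 = p0, h (n+1) = F (h n) (τ n) (cex n), where cex n is the verifier's
   answer on the hypothesis h n. *)
Fixpoint hyp (F : nat -> option nat -> option nat -> nat) (p0 : nat)
    (tau cex : nat -> option nat) (n : nat) : nat :=
  match n with
  | 0 => p0
  | S k => F (hyp F p0 tau cex k) (tau k) (cex k)
  end.

Definition engine_recursive (F : nat -> option nat -> option nat -> nat) : Prop :=
  exists c : code, forall p a b, eval c [p; enc a; enc b] (F p a b).

Definition converges_to (h : nat -> nat) (i : nat) : Prop :=
  exists N, forall n, N <= n -> h n = i.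

Definition cegis_identifies (L : nat -> lang)
    (F : nat -> option nat -> option nat -> nat) (p0 i : nat) : Prop :=
  forall tau cex, is_trace (L i) tau ->
    (forall n, check_ok (L i) (L (hyp F p0 tau cex n)) (cex n)) ->
    converges_to (hyp F p0 tau cex) i.

Definition hcegis_identifies (L : nat -> lang)
    (F : nat -> option nat -> option nat -> nat) (p0 i : nat) : Prop :=
  forall tau cex, is_trace (L i) tau ->
    (forall n, hcheck_ok (L i) (L (hyp F p0 tau cex n)) tau n (cex n)) ->
    converges_to (hyp F p0 tau cex) i.

Definition in_CEGIS (L : nat -> lang) : Prop :=
  exists F p0, engine_recursive F /\ forall i, cegis_identifies L F p0 i.

Definition in_HCEGIS (L : nat -> lang) : Prop :=
  exists F p0, engine_recursive F /\ forall i, hcegis_identifies L F p0 i.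

(* Main.v *)
From Stdlib Require Import List Arith Lia Bool Cantor PeanoNat Classical ClassicalEpsilon.
Require Import Defs.
Import ListNotations.

(** An engine has no memory except its current hypothesis, so whatever it saw before
    visiting a hypothesis is forgotten there. Let [K] be a recursively enumerable,
    undecidable set. The family contains infinite languages [J_q], and for each
    parameter [z] (which includes a candidate [e] for [K]) a language [B_z] and, exactly
    if [e] is in [K], a language [B'_z] which is [B_z] plus finitely many elements of
    [J_q]; the index of [B'_z] is a certificate for [e] in [K], hence cannot be computed.

    A CEGIS engine that identifies [J_q] can be led to [J_q] both after having seen the
    elements of [B'_z] that are not in [B_z] and without having seen them. Afterwards
    the verifier answers every other hypothesis by an uninformative label, so the engine
    has to reach [B'_z] before [B_z] if [B'_z] exists, since it cannot leave [B_z], and to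
    reach [B_z] otherwise; simulating it decides [K].

    With history-bounded counterexamples the engine tries hypotheses that contain [B'_z]
    except that their labels are larger than everything seen. The verifier must then
    return an element of [B'_z] outside [B_z] if the target is [B_z]; if it never does, the
    engine goes on until it finds the certificate and with it [B'_z]. *)

(** * Recursive functions *)

Definition Rec (n : nat) (f : list nat -> nat) : Prop :=
  exists c, forall v, length v = n -> eval c v (f v).

Definition recursive1 (f : nat -> nat) : Prop :=
  exists c : code, forall x, eval c [x] (f x).

Lemma Rec_ext n f g :
  (forall v, length v = n -> f v = g v) -> Rec n f -> Rec n g.
Proof.
  intros E [c Hc]; exists c; intros v Hv; rewrite <- E by exact Hv; auto.
Qed.

Lemma Rec_proj n i : i < n -> Rec n (fun v => nth i v 0).
Proof. intros Hi; exists (CProj i); intros v Hv; constructor; lia. Qed.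

(** Under a binder the outer variables sit behind [tl]; this rule moves the shift into the index. *)
Lemma Rec_proj_tl n i (g : list nat -> list nat) :
  Rec n (fun v => nth (S i) (g v) 0) -> Rec n (fun v => nth i (tl (g v)) 0).
Proof.
  apply Rec_ext; intros v _; destruct (g v) as [|x l]; [destruct i|]; reflexivity.
Qed.

Lemma Rec_const n k : Rec n (fun _ => k).
Proof.
  induction k as [|k [c Hc]].
  - exists CZero; intros; constructor.
  - exists (CComp CSucc [c]); intros v Hv.
    apply ev_comp with [k]; repeat constructor; auto.
Qed.

Lemma Rec_app1 g n a :
  recursive1 g -> Rec n a -> Rec n (fun v => g (a v)).
Proof.
  intros [c Hc] [ca Ha]; exists (CComp c [ca]); intros v Hv.
  apply ev_comp with [a v]; repeat constructor; auto.
Qed.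

Lemma Rec_app2 g n a b :
  recursive2 g -> Rec n a -> Rec n b -> Rec n (fun v => g (a v) (b v)).
Proof.
  intros [c Hc] [ca Ha] [cb Hb]; exists (CComp c [ca; cb]); intros v Hv.
  apply ev_comp with [a v; b v]; repeat constructor; auto.
Qed.

Lemma Rec_app3 g n a b d :
  recursive3 g -> Rec n a -> Rec n b -> Rec n d ->
  Rec n (fun v => g (a v) (b v) (d v)).
Proof.
  intros [c Hc] [ca Ha] [cb Hb] [cd Hd]; exists (CComp c [ca; cb; cd]); intros v Hv.
  apply ev_comp with [a v; b v; d v]; repeat constructor; auto.
Qed.

Lemma recursive1_intro f : Rec 1 (fun v => f (nth 0 v 0)) -> recursive1 f.
Proof. intros [c Hc]; exists c; intros x; exact (Hc [x] eq_refl). Qed.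

Lemma recursive2_intro f :
  Rec 2 (fun v => f (nth 0 v 0) (nth 1 v 0)) -> recursive2 f.
Proof. intros [c Hc]; exists c; intros x y; exact (Hc [x; y] eq_refl). Qed.

Lemma recursive3_intro f :
  Rec 3 (fun v => f (nth 0 v 0) (nth 1 v 0) (nth 2 v 0)) -> recursive3 f.
Proof. intros [c Hc]; exists c; intros x y z; exact (Hc [x; y; z] eq_refl). Qed.

Lemma recursive1_S : recursive1 S.
Proof. exists CSucc; constructor. Qed.

Fixpoint natrec (x : nat) (g : nat -> nat -> nat) (n : nat) : nat :=
  match n with 0 => x | S k => g k (natrec x g k) end.

Lemma evals_projs (v w : list nat) :
  evals (map CProj (seq (length w) (length v))) (w ++ v) v.
Proof.
  revert w; induction v as [|x v IH]; intros w; simpl; constructor.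
  - pose proof (ev_proj (length w) (w ++ x :: v)) as H; rewrite nth_middle in H.
    apply H; rewrite length_app; simpl; lia.
  - specialize (IH (w ++ [x])).
    rewrite length_app, <- app_assoc, Nat.add_1_r in IH; exact IH.
Qed.

(** [CPrec] hands its step the counter, the previous value and then the parameters, hence the order
    of arguments of [g]. The projections pass all of [v] on as parameters. *)
Lemma Rec_natrec n b f g :
  Rec n b -> Rec n f ->
  Rec (S (S n)) (fun w => g (tl (tl w)) (nth 0 w 0) (nth 1 w 0)) ->
  Rec n (fun v => natrec (f v) (g v) (b v)).
Proof.
  intros [cb Hb] [cf Hf] [cg Hg].
  exists (CComp (CPrec cf cg) (cb :: map CProj (seq 0 n))); intros v Hv.
  apply ev_comp with (b v :: v).
  - constructor; [auto|]. rewrite <- Hv. apply (evals_projs v []).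
  - generalize (b v) as m; induction m as [|m IH]; simpl.
    + constructor; auto.
    + econstructor; [exact IH|].
      apply (Hg (m :: natrec (f v) (g v) m :: v)); simpl; lia.
Qed.

(** [CMu] looks for a zero, so the test is negated. *)
Lemma Rec_min n (p : list nat -> nat -> bool) f :
  Rec (S n) (fun w => Nat.b2n (negb (p (tl w) (nth 0 w 0)))) ->
  (forall v, length v = n -> p v (f v) = true) ->
  (forall v m, length v = n -> m < f v -> p v m = false) ->
  Rec n f.
Proof.
  intros [c Hc] H1 H2; exists (CMu c); intros v Hv; constructor.
  - specialize (Hc (f v :: v)); simpl in Hc; rewrite H1 in Hc by exact Hv.
    apply Hc; lia.
  - intros m Hm; exists 0.
    specialize (Hc (m :: v)); simpl in Hc; rewrite H2 in Hc by assumption.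
    apply Hc; lia.
Qed.

Create HintDb recdb.
#[global] Hint Resolve recursive1_S : recdb.

Lemma recursive2_plus : recursive2 Nat.add.
Proof.
  apply recursive2_intro.
  apply Rec_ext with (fun v => natrec (nth 1 v 0) (fun _ r => S r) (nth 0 v 0)).
  - intros v _; induction (nth 0 v 0); simpl; auto.
  - apply Rec_natrec; try (apply Rec_proj; lia).
    apply (Rec_app1 S); [apply recursive1_S | apply Rec_proj; lia].
Qed.
#[global] Hint Resolve recursive2_plus : recdb.

Lemma recursive2_mult : recursive2 Nat.mul.
Proof.
  apply recursive2_intro.
  apply Rec_ext with (fun v => natrec 0 (fun _ r => nth 1 v 0 + r) (nth 0 v 0)).
  - intros v _; induction (nth 0 v 0); simpl; auto.
  - apply (Rec_natrec 2 _ _ (fun v _ r => nth 1 v 0 + r));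
      [apply Rec_proj; lia | apply Rec_const | ].
    apply (Rec_app2 Nat.add); [apply recursive2_plus | | apply Rec_proj; lia].
    do 2 apply Rec_proj_tl; apply Rec_proj; lia.
Qed.
#[global] Hint Resolve recursive2_mult : recdb.

Lemma recursive1_pred : recursive1 Nat.pred.
Proof.
  apply recursive1_intro.
  apply Rec_ext with (fun v => natrec 0 (fun k _ => k) (nth 0 v 0)).
  - intros v _; destruct (nth 0 v 0); reflexivity.
  - apply Rec_natrec; [apply Rec_proj; lia | apply Rec_const | apply Rec_proj; lia].
Qed.
#[global] Hint Resolve recursive1_pred : recdb.

Lemma recursive2_minus : recursive2 Nat.sub.
Proof.
  apply recursive2_intro.
  apply Rec_ext with (fun v => natrec (nth 0 v 0) (fun _ r => Nat.pred r) (nth 1 v 0)).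
  - intros v _; induction (nth 1 v 0); simpl; lia.
  - apply Rec_natrec; try (apply Rec_proj; lia).
    apply (Rec_app1 Nat.pred); [apply recursive1_pred | apply Rec_proj; lia].
Qed.
#[global] Hint Resolve recursive2_minus : recdb.

Definition exb (b : nat) (p : nat -> bool) : bool := existsb p (seq 0 b).
Definition allb (b : nat) (p : nat -> bool) : bool := forallb p (seq 0 b).

Lemma exb_true b p : exb b p = true <-> exists i, i < b /\ p i = true.
Proof.
  unfold exb; rewrite existsb_exists; split; intros [i [H1 H2]]; exists i;
    rewrite in_seq in *; split; auto; lia.
Qed.

Lemma allb_true b p : allb b p = true <-> forall i, i < b -> p i = true.
Proof.
  unfold allb; rewrite forallb_forall; split; intros H i Hi; apply H;
    rewrite in_seq in *; lia.
Qed.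

Lemma Rec_if n (p : list nat -> bool) a b :
  Rec n (fun v => Nat.b2n (p v)) -> Rec n a -> Rec n b ->
  Rec n (fun v => if p v then a v else b v).
Proof.
  intros Hp Ha Hb.
  apply Rec_ext with (fun v => Nat.b2n (p v) * a v + (1 - Nat.b2n (p v)) * b v).
  - intros v _; destruct (p v); cbn [Nat.b2n]; lia.
  - repeat first [ assumption | apply Rec_const | apply recursive2_plus
                 | apply recursive2_mult | apply recursive2_minus
                 | apply (Rec_app2 Nat.add) | apply (Rec_app2 Nat.mul)
                 | apply (Rec_app2 Nat.sub) ].
Qed.

Lemma Rec_b2n_if n (p q r : list nat -> bool) :
  Rec n (fun v => Nat.b2n (p v)) -> Rec n (fun v => Nat.b2n (q v)) ->
  Rec n (fun v => Nat.b2n (r v)) ->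
  Rec n (fun v => Nat.b2n (if p v then q v else r v)).
Proof.
  intros Hp Hq Hr; eapply Rec_ext; [|exact (Rec_if _ _ _ _ Hp Hq Hr)].
  intros v _; cbv beta; destruct (p v); reflexivity.
Qed.

Lemma Rec_true n : Rec n (fun _ => Nat.b2n true).
Proof. apply Rec_const. Qed.

Lemma Rec_false n : Rec n (fun _ => Nat.b2n false).
Proof. apply Rec_const. Qed.

Lemma Rec_negb n (p : list nat -> bool) :
  Rec n (fun v => Nat.b2n (p v)) -> Rec n (fun v => Nat.b2n (negb (p v))).
Proof. intros Hp; apply (Rec_b2n_if _ _ _ _ Hp (Rec_false n) (Rec_true n)). Qed.

Lemma Rec_andb n (p q : list nat -> bool) :
  Rec n (fun v => Nat.b2n (p v)) -> Rec n (fun v => Nat.b2n (q v)) ->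
  Rec n (fun v => Nat.b2n (p v && q v)).
Proof. intros Hp Hq; apply (Rec_b2n_if _ _ _ _ Hp Hq (Rec_false n)). Qed.

Lemma Rec_orb n (p q : list nat -> bool) :
  Rec n (fun v => Nat.b2n (p v)) -> Rec n (fun v => Nat.b2n (q v)) ->
  Rec n (fun v => Nat.b2n (p v || q v)).
Proof. intros Hp Hq; apply (Rec_b2n_if _ _ _ _ Hp (Rec_true n) Hq). Qed.

Lemma Rec_leb n a b :
  Rec n a -> Rec n b -> Rec n (fun v => Nat.b2n (a v <=? b v)).
Proof.
  intros Ha Hb; apply Rec_ext with (fun v => 1 - (a v - b v)).
  - intros v _; destruct (Nat.leb_spec (a v) (b v)); cbn [Nat.b2n]; lia.
  - apply (Rec_app2 Nat.sub); [apply recursive2_minus | apply Rec_const |].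
    apply (Rec_app2 Nat.sub); [apply recursive2_minus | |]; assumption.
Qed.

Lemma Rec_ltb n a b :
  Rec n a -> Rec n b -> Rec n (fun v => Nat.b2n (a v <? b v)).
Proof.
  intros Ha Hb; apply (Rec_leb n (fun v => S (a v)) b); [|exact Hb].
  apply (Rec_app1 S); [apply recursive1_S | exact Ha].
Qed.

Lemma Rec_eqb n a b :
  Rec n a -> Rec n b -> Rec n (fun v => Nat.b2n (a v =? b v)).
Proof.
  intros Ha Hb; apply Rec_ext with (fun v => Nat.b2n ((a v <=? b v) && (b v <=? a v))).
  - intros v _; f_equal; destruct (Nat.eqb_spec (a v) (b v)) as [->|E].
    + rewrite Nat.leb_refl; reflexivity.
    + destruct (Nat.leb_spec (a v) (b v)), (Nat.leb_spec (b v) (a v)); simpl; lia.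
  - apply Rec_andb; apply Rec_leb; assumption.
Qed.

Lemma Rec_exb n b (p : list nat -> nat -> bool) :
  Rec n b -> Rec (S n) (fun w => Nat.b2n (p (tl w) (nth 0 w 0))) ->
  Rec n (fun v => Nat.b2n (exb (b v) (p v))).
Proof.
  intros Hb [c Hc].
  apply Rec_ext with
    (fun v => natrec 0 (fun i r => if 0 <? r then 1 else Nat.b2n (p v i)) (b v)).
  - intros v _; unfold exb; induction (b v) as [|m IH]; [reflexivity|].
    rewrite seq_S, existsb_app; simpl; rewrite IH.
    destruct (existsb (p v) (seq 0 m)); simpl; [|rewrite orb_false_r]; reflexivity.
  - apply (Rec_natrec n _ _ (fun v i r => if 0 <? r then 1 else Nat.b2n (p v i)));
      [exact Hb | apply Rec_const |].
    apply Rec_if; [apply Rec_ltb; [apply Rec_const | apply Rec_proj; lia]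
                  | apply Rec_const |].
    (* The recursion puts the accumulator between counter and parameters, but [c] expects the
       counter and the parameters only, so the accumulator is projected away. *)
    exists (CComp c (CProj 0 :: map CProj (seq 2 n))).
    intros [|i [|r v]] Hv; try discriminate; simpl in Hv |- *.
    apply ev_comp with (i :: v).
    + constructor; [apply (ev_proj 0 (i :: r :: v)); simpl; lia |].
      replace n with (length v) by lia; exact (evals_projs v [i; r]).
    + apply (Hc (i :: v)); simpl; lia.
Qed.

Lemma Rec_allb n b (p : list nat -> nat -> bool) :
  Rec n b -> Rec (S n) (fun w => Nat.b2n (p (tl w) (nth 0 w 0))) ->
  Rec n (fun v => Nat.b2n (allb (b v) (p v))).
Proof.
  intros Hb Hp; apply Rec_ext with
    (fun v => Nat.b2n (negb (exb (b v) (fun i => negb (p v i))))).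
  - intros v _; f_equal; unfold exb, allb.
    induction (seq 0 (b v)) as [|i l IH]; simpl; [reflexivity|].
    rewrite negb_orb, negb_involutive, IH; reflexivity.
  - apply Rec_negb; apply (Rec_exb n b (fun v i => negb (p v i))); [exact Hb|].
    apply Rec_negb; exact Hp.
Qed.

(* The binder rules turn outer variables into [nth i (tl (... (tl v))) 0]; matching
   tries high arities first because a pattern [?g (@?a v)] may capture [v] in [?g]. *)
Ltac rec :=
  cbv beta;
  first [apply Rec_const |
  lazymatch goal with
  | |- Rec _ (fun v => nth _ v 0) => apply Rec_proj; lia
  | |- Rec _ (fun v => nth _ (tl _) 0) => apply Rec_proj_tl; rec
  | |- Rec _ (fun v => Nat.b2n (if _ then _ else _)) => apply Rec_b2n_if; rec
  | |- Rec _ (fun v => Nat.b2n (negb _)) => apply Rec_negb; rec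
  | |- Rec _ (fun v => Nat.b2n (_ && _)) => apply Rec_andb; rec
  | |- Rec _ (fun v => Nat.b2n (_ || _)) => apply Rec_orb; rec
  | |- Rec _ (fun v => Nat.b2n (_ <? _)) => apply Rec_ltb; rec
  | |- Rec _ (fun v => Nat.b2n (_ <=? _)) => apply Rec_leb; rec
  | |- Rec _ (fun v => Nat.b2n (_ =? _)) => apply Rec_eqb; rec
  | |- Rec ?n (fun v => Nat.b2n (exb (@?b v) (@?p v))) => apply (Rec_exb n b p); rec
  | |- Rec ?n (fun v => Nat.b2n (allb (@?b v) (@?p v))) => apply (Rec_allb n b p); rec
  | |- Rec ?n (fun v => Nat.b2n (?g (@?a v) (@?b v) (@?d v))) =>
      apply (Rec_app3 (fun x y z => Nat.b2n (g x y z)) n a b d); [solve [auto with recdb] | rec ..]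
  | |- Rec ?n (fun v => Nat.b2n (?g (@?a v) (@?b v))) =>
      apply (Rec_app2 (fun x y => Nat.b2n (g x y)) n a b); [solve [auto with recdb] | rec ..]
  | |- Rec ?n (fun v => Nat.b2n (?g (@?a v))) =>
      apply (Rec_app1 (fun x => Nat.b2n (g x)) n a); [solve [auto with recdb] | rec]
  | |- Rec _ (fun v => if _ then _ else _) => apply Rec_if; rec
  | |- Rec ?n (fun v => natrec (@?x v) (@?g v) (@?b v)) => apply (Rec_natrec n b x g); rec
  | |- Rec ?n (fun v => ?g (@?a v) (@?b v) (@?d v)) =>
      apply (Rec_app3 g n a b d); [solve [auto with recdb] | rec ..]
  | |- Rec ?n (fun v => ?g (@?a v) (@?b v)) =>
      apply (Rec_app2 g n a b); [solve [auto with recdb] | rec ..]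
  | |- Rec ?n (fun v => ?g (@?a v)) => apply (Rec_app1 g n a); [solve [auto with recdb] | rec]
  end].

(** * Arithmetic and the Cantor pairing *)

Lemma recursive2_div : recursive2 Nat.div.
Proof.
  apply recursive2_intro.
  (* For divisor 0 the test succeeds at once, in agreement with [x / 0 = 0]. *)
  apply Rec_min with
    (fun v q => (nth 1 v 0 =? 0) || (nth 0 v 0 <? nth 1 v 0 * S q)).
  - rec.
  - intros v _; generalize (nth 0 v 0) as x, (nth 1 v 0) as y; intros x y.
    destruct (Nat.eqb_spec y 0); [reflexivity|].
    apply Nat.ltb_lt, Nat.mul_succ_div_gt; assumption.
  - intros v m _; generalize (nth 0 v 0) as x, (nth 1 v 0) as y; intros x y Hm.
    destruct (Nat.eqb_spec y 0) as [->|Hy]; [simpl in Hm; lia|].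
    apply Nat.ltb_ge. pose proof (Nat.Div0.mul_div_le x y). nia.
Qed.
#[global] Hint Resolve recursive2_div : recdb.

Lemma recursive2_modulo : recursive2 Nat.modulo.
Proof.
  apply recursive2_intro.
  apply Rec_ext with (fun v => nth 0 v 0 - nth 1 v 0 * (nth 0 v 0 / nth 1 v 0)).
  - intros v _; pose proof (Nat.div_mod_eq (nth 0 v 0) (nth 1 v 0)); lia.
  - rec.
Qed.
#[global] Hint Resolve recursive2_modulo : recdb.

Lemma recursive2_pow : recursive2 Nat.pow.
Proof.
  apply recursive2_intro.
  apply Rec_ext with (fun v => natrec 1 (fun _ r => nth 0 v 0 * r) (nth 1 v 0)).
  - intros v _; induction (nth 1 v 0); simpl; auto.
  - rec.
Qed.
#[global] Hint Resolve recursive2_pow : recdb.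

Lemma recursive2_testbit : recursive2 (fun s x => Nat.b2n (Nat.testbit s x)).
Proof.
  apply recursive2_intro.
  apply Rec_ext with (fun v => (nth 0 v 0 / 2 ^ nth 1 v 0) mod 2).
  - intros v _; symmetry; apply Nat.testbit_spec'.
  - rec.
Qed.
#[global] Hint Resolve recursive2_testbit : recdb.

(* Sealed, so that [inversion] and [simpl] do not compute with the Cantor pairing. *)
Lemma cpair_sealed : {p : nat -> nat -> nat | forall x y, p x y = Cantor.to_nat (x, y)}.
Proof. exists (fun x y => Cantor.to_nat (x, y)); reflexivity. Qed.

Definition cpair : nat -> nat -> nat := proj1_sig cpair_sealed.

Lemma cpairE x y : cpair x y = Cantor.to_nat (x, y).
Proof. exact (proj2_sig cpair_sealed x y). Qed.

Definition pi1 (n : nat) : nat := fst (Cantor.of_nat n).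
Definition pi2 (n : nat) : nat := snd (Cantor.of_nat n).

Lemma pi1_cpair x y : pi1 (cpair x y) = x.
Proof. unfold pi1; rewrite cpairE, Cantor.cancel_of_to; reflexivity. Qed.

Lemma pi2_cpair x y : pi2 (cpair x y) = y.
Proof. unfold pi2; rewrite cpairE, Cantor.cancel_of_to; reflexivity. Qed.

Lemma cpair_pi n : cpair (pi1 n) (pi2 n) = n.
Proof.
  rewrite cpairE; unfold pi1, pi2; rewrite <- surjective_pairing; apply Cantor.cancel_to_of.
Qed.

Lemma cpair_inj x y x' y' : cpair x y = cpair x' y' -> x = x' /\ y = y'.
Proof.
  intros H; split.
  - rewrite <- (pi1_cpair x y), H; apply pi1_cpair.
  - rewrite <- (pi2_cpair x y), H; apply pi2_cpair.
Qed.

Lemma cpair_ge x y : x + y <= cpair x y.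
Proof. pose proof (Cantor.to_nat_non_decreasing x y); rewrite cpairE; lia. Qed.

Lemma recursive2_cpair : recursive2 cpair.
Proof.
  apply recursive2_intro.
  apply Rec_ext with (fun v => nth 1 v 0 +
    natrec 0 (fun i m => S i + m) (nth 1 v 0 + nth 0 v 0)).
  - intros v _; rewrite cpairE; unfold Cantor.to_nat; f_equal.
    induction (nth 1 v 0 + nth 0 v 0) as [|k IH]; [reflexivity|].
    simpl in IH |- *; lia.
  - rec.
Qed.
#[global] Hint Resolve recursive2_cpair : recdb.

(** The second component is at most the pair, so a candidate for the first one is tested by a
    bounded search. *)
Lemma recursive1_pi1 : recursive1 pi1.
Proof.
  apply recursive1_intro.
  apply Rec_min with (fun v x => exb (S (nth 0 v 0)) (fun y => cpair x y =? nth 0 v 0)).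
  - rec.
  - intros v _; apply exb_true; exists (pi2 (nth 0 v 0)).
    rewrite cpair_pi, Nat.eqb_refl; split; [|reflexivity].
    pose proof (cpair_ge (pi1 (nth 0 v 0)) (pi2 (nth 0 v 0))) as H.
    rewrite cpair_pi in H; lia.
  - intros v m _ Hm; apply not_true_is_false; rewrite exb_true; intros [y [_ Hy]].
    apply Nat.eqb_eq in Hy; rewrite <- Hy, pi1_cpair in Hm; lia.
Qed.
#[global] Hint Resolve recursive1_pi1 : recdb.

Lemma recursive1_pi2 : recursive1 pi2.
Proof.
  apply recursive1_intro.
  apply Rec_min with (fun v y => cpair (pi1 (nth 0 v 0)) y =? nth 0 v 0).
  - rec.
  - intros v _; rewrite cpair_pi; apply Nat.eqb_refl.
  - intros v m _ Hm; apply Nat.eqb_neq; intros E.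
    rewrite <- E, pi2_cpair in Hm; lia.
Qed.
#[global] Hint Resolve recursive1_pi2 : recdb.

(** * Derivations of [eval] as sets of claims *)

Definition lcons (x l : nat) : nat := S (cpair x l).

Definition lnum (l : list nat) : nat := fold_right lcons 0 l.

Fixpoint num (c : code) : nat :=
  match c with
  | CZero => cpair 0 0
  | CSucc => cpair 1 0
  | CProj i => cpair 2 i
  | CComp f gs => cpair 3 (cpair (num f) (lnum (map num gs)))
  | CPrec f g => cpair 4 (cpair (num f) (num g))
  | CMu f => cpair 5 (num f)
  end.

(* The claim, at stage [k], that [eval c v y]; the tag 6 marks claims about [evals]. *)
Definition claim (k c v y : nat) : nat := cpair k (cpair c (cpair v y)).

(* Stages make justification well founded. Projections are unfolded one step at a
   time, so that no rule needs [nth]. *)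
Inductive Just (M : nat -> Prop) (k : nat) : nat -> nat -> nat -> Prop :=
| J_zero v : Just M k (cpair 0 0) v 0
| J_succ x v : Just M k (cpair 1 0) (lcons x v) (S x)
| J_proj0 x v : Just M k (cpair 2 0) (lcons x v) x
| J_projS i x v y k1 : M (claim k1 (cpair 2 i) v y) -> k1 < k ->
    Just M k (cpair 2 (S i)) (lcons x v) y
| J_comp f gs v ws y k1 k2 :
    M (claim k1 (cpair 6 gs) v ws) -> M (claim k2 f ws y) -> k1 < k -> k2 < k ->
    Just M k (cpair 3 (cpair f gs)) v y
| J_prec0 f g v y k1 : M (claim k1 f v y) -> k1 < k ->
    Just M k (cpair 4 (cpair f g)) (lcons 0 v) y
| J_precS f g n v y z k1 k2 :
    M (claim k1 (cpair 4 (cpair f g)) (lcons n v) y) ->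
    M (claim k2 g (lcons n (lcons y v)) z) -> k1 < k -> k2 < k ->
    Just M k (cpair 4 (cpair f g)) (lcons (S n) v) z
| J_mu f v n k1 : M (claim k1 f (lcons n v) 0) -> k1 < k ->
    (forall m, m < n -> exists k2 w, M (claim k2 f (lcons m v) (S w)) /\ k2 < k) ->
    Just M k (cpair 5 f) v n
| J_nil v : Just M k (cpair 6 0) v 0
| J_cons g gs v w ws k1 k2 :
    M (claim k1 g v w) -> M (claim k2 (cpair 6 gs) v ws) -> k1 < k -> k2 < k ->
    Just M k (cpair 6 (lcons g gs)) v (lcons w ws).

Definition Closed (M : nat -> Prop) : Prop :=
  forall k c v y, M (claim k c v y) -> Just M k c v y.

Lemma Just_mono (M M' : nat -> Prop) k c v y :
  (forall x, M x -> M' x) -> Just M k c v y -> Just M' k c v y.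
Proof.
  intros H J; destruct J; try (econstructor; solve [eauto]).
  eapply J_mu; eauto; intros m Hm.
  destruct (H2 m Hm) as [k2 [w [? ?]]]; eauto.
Qed.

Lemma lcons_inj x l x' l' : lcons x l = lcons x' l' -> x = x' /\ l = l'.
Proof. intros H; apply Nat.succ_inj, cpair_inj in H; exact H. Qed.

Ltac pairs :=
  simpl in *;
  repeat match goal with
  | H : cpair _ _ = cpair _ _ |- _ => apply cpair_inj in H; destruct H
  | H : lcons _ _ = lcons _ _ |- _ => apply lcons_inj in H; destruct H
  | H : S _ = S _ |- _ => apply Nat.succ_inj in H
  | H : lcons _ _ = lnum (map num ?v) |- _ => destruct v; simpl in H
  | H : lcons _ _ = lnum ?v |- _ => destruct v; simpl in H
  | H : 0 = lnum (map num ?v) |- _ => destruct v; simpl in H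
  end; try discriminate; subst.

(** Induction on the stage: a claim about the number of a code is justified only by claims at
    smaller stages about its subcodes. In the [evals] case the result is not known beforehand to
    code a list, hence the existential. *)
Lemma Closed_sound M : Closed M -> forall k,
  (forall c v y, M (claim k (num c) (lnum v) y) -> eval c v y) /\
  (forall gs v w, M (claim k (cpair 6 (lnum (map num gs))) (lnum v) w) ->
     exists ws, w = lnum ws /\ evals gs v ws).
Proof.
  intros HM k; induction k as [k IH] using lt_wf_ind.
  assert (IH1 : forall k1 c v y, k1 < k -> M (claim k1 (num c) (lnum v) y) -> eval c v y)
    by (intros; eapply IH; eauto).
  assert (IH2 : forall k1 gs v w, k1 < k ->
    M (claim k1 (cpair 6 (lnum (map num gs))) (lnum v) w) ->
    exists ws, w = lnum ws /\ evals gs v ws)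
    by (intros; eapply IH; eauto).
  clear IH; split.
  - intros c v y H; apply HM in H.
    destruct c as [| | i | f gs | f g | f]; inversion H; pairs.
    + constructor.
    + constructor.
    + apply (ev_proj 0 (_ :: _)); simpl; lia.
    + match goal with H : M (claim ?a (cpair 2 ?j) (lnum ?w) ?z) |- _ =>
        assert (E : eval (CProj j) w z) by (eapply IH1; eauto) end.
      inversion E; subst; apply (ev_proj (S _) (_ :: _)); simpl; lia.
    + match goal with H : M (claim _ (cpair 6 _) _ _) |- _ =>
        eapply IH2 in H; [destruct H as [ws' [-> E]] | assumption] end.
      eapply ev_comp; [exact E | eauto].
    + constructor; eauto.
    + eapply ev_precS; [apply (IH1 k1 (CPrec f g) (_ :: _)) | apply (IH1 k2 g (_ :: _ :: _))];
        eassumption.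
    + constructor; [apply (IH1 k1 f (_ :: _)); assumption|].
      intros m Hm; match goal with H : forall m, m < _ -> _ |- _ =>
        destruct (H m Hm) as [k2 [w [Hw Hk2]]] end.
      exists w; exact (IH1 k2 f (m :: v) (S w) Hk2 Hw).
  - intros gs v w H; apply HM in H; inversion H; pairs.
    + exists []; split; constructor.
    + match goal with H : M (claim _ (cpair 6 _) _ _) |- _ =>
        eapply IH2 in H; [destruct H as [ws' [-> E]] | assumption] end.
      eexists (_ :: _); split; [reflexivity | constructor; eauto].
Qed.

(** Finiteness of the closed set is what allows a single number to code it later. *)
Definition Derivable (c v y : nat) : Prop :=
  exists l k, Closed (fun x => In x l) /\ In (claim k c v y) l.

Lemma Closed_app l1 l2 :
  Closed (fun x => In x l1) -> Closed (fun x => In x l2) ->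
  Closed (fun x => In x (l1 ++ l2)).
Proof.
  intros H1 H2 k c v y H; apply in_app_or in H; destruct H as [H|H];
    [apply H1 in H | apply H2 in H]; revert H; apply Just_mono;
    intros x Hx; apply in_or_app; auto.
Qed.

Lemma claim_inj k c v y k' c' v' y' :
  claim k c v y = claim k' c' v' y' -> k = k' /\ c = c' /\ v = v' /\ y = y'.
Proof.
  unfold claim; intros H; do 3 (apply cpair_inj in H; destruct H as [? H]); auto.
Qed.

Lemma Derivable_step l k c v y :
  Closed (fun x => In x l) -> Just (fun x => In x l) k c v y -> Derivable c v y.
Proof.
  intros Hl J; exists (claim k c v y :: l), k; split; [|left; reflexivity].
  intros k' c' v' y' [E|H].
  - apply claim_inj in E; destruct E as [-> [-> [-> ->]]].
    revert J; apply Just_mono; simpl; auto.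
  - apply Hl in H; revert H; apply Just_mono; simpl; auto.
Qed.

Lemma Derivable0 c v y : (forall M, Just M 0 c v y) -> Derivable c v y.
Proof. intros J; apply (Derivable_step [] 0); [intros ? ? ? ? [] | apply J]. Qed.

Lemma Derivable1 c v y c1 v1 y1 :
  Derivable c1 v1 y1 ->
  (forall (M : nat -> Prop) k k1, k1 < k -> M (claim k1 c1 v1 y1) -> Just M k c v y) ->
  Derivable c v y.
Proof.
  intros [l [k [H1 H2]]] J; apply (Derivable_step l (S k)); [assumption|].
  apply J with k; auto.
Qed.

Lemma Derivable2 c v y c1 v1 y1 c2 v2 y2 :
  Derivable c1 v1 y1 -> Derivable c2 v2 y2 ->
  (forall (M : nat -> Prop) k k1 k2, k1 < k -> k2 < k ->
     M (claim k1 c1 v1 y1) -> M (claim k2 c2 v2 y2) -> Just M k c v y) ->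
  Derivable c v y.
Proof.
  intros [l1 [k1 [H1 I1]]] [l2 [k2 [H2 I2]]] J.
  apply (Derivable_step (l1 ++ l2) (S (k1 + k2))); [apply Closed_app; assumption|].
  apply J with k1 k2; try lia; apply in_or_app; auto.
Qed.

(** Each [m < n] comes with its own closed list; [Hb] merges these finitely many lists by induction
    and finds a common bound on the stages. *)
Lemma Derivable_mu f v n :
  Derivable f (lcons n v) 0 ->
  (forall m, m < n -> exists w, Derivable f (lcons m v) (S w)) ->
  Derivable (cpair 5 f) v n.
Proof.
  intros [l [k [H I]]] Hm.
  assert (Hb : forall b, b <= n -> exists l' k', Closed (fun x => In x l') /\
    forall m, m < b -> exists k2 w, k2 < k' /\ In (claim k2 f (lcons m v) (S w)) l').
  { induction b as [|b IH]; intros Hb.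
    - exists [], 0; split; [intros ? ? ? ? [] | intros; lia].
    - destruct IH as [l1 [k1 [C1 I1]]]; [lia|].
      destruct (Hm b) as [w [l2 [k2 [C2 I2]]]]; [lia|].
      exists (l1 ++ l2), (S (k1 + k2)); split; [apply Closed_app; assumption|].
      intros m Hmb; destruct (Nat.eq_dec m b) as [->|].
      + exists k2, w; split; [lia | apply in_or_app; auto].
      + destruct (I1 m) as [k3 [w' [? ?]]]; [lia|].
        exists k3, w'; split; [lia | apply in_or_app; auto]. }
  destruct (Hb n (le_n n)) as [l' [k' [C' I']]].
  apply (Derivable_step (l ++ l') (S (k + k'))); [apply Closed_app; assumption|].
  apply J_mu with k; [apply in_or_app; auto | lia |].
  intros m Hmn; destruct (I' m Hmn) as [k2 [w [? ?]]].
  exists k2, w; split; [apply in_or_app; auto | lia].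
Qed.

Lemma Derivable_proj i v :
  i < length v -> Derivable (cpair 2 i) (lnum v) (nth i v 0).
Proof.
  revert i; induction v as [|x v IH]; intros [|i] Hi; simpl in *; try lia.
  - apply Derivable0; intros; constructor.
  - apply (Derivable1 _ _ _ _ _ _ (IH i ltac:(lia))); intros; econstructor; eauto.
Qed.

(** By structural recursion on the derivation, because in [ev_mu] the derivations for smaller
    arguments sit under an existential. *)
Lemma eval_Derivable c v y : eval c v y -> Derivable (num c) (lnum v) y
with evals_Derivable gs v ws :
  evals gs v ws -> Derivable (cpair 6 (lnum (map num gs))) (lnum v) (lnum ws).
Proof.
  - intros H; destruct H as [v | x v | i v Hi | f gs v ws y Hs H | f g v y H
      | f g n v y z H1 H2 | f v n H Hm]; simpl.
    + apply Derivable0; intros; constructor.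
    + apply Derivable0; intros; constructor.
    + apply Derivable_proj; exact Hi.
    + apply (Derivable2 _ _ _ _ _ _ _ _ _ (evals_Derivable _ _ _ Hs)
               (eval_Derivable _ _ _ H)); intros; econstructor; eauto.
    + apply (Derivable1 _ _ _ _ _ _ (eval_Derivable _ _ _ H));
        intros; econstructor; eauto.
    + apply (Derivable2 _ _ _ _ _ _ _ _ _ (eval_Derivable _ _ _ H1)
               (eval_Derivable _ _ _ H2)); intros; eapply J_precS; eauto.
    + apply Derivable_mu; [exact (eval_Derivable _ _ _ H)|].
      intros m Hmn; destruct (Hm m Hmn) as [k Hk].
      exists k; exact (eval_Derivable _ _ _ Hk).
  - intros H; destruct H as [v | g gs v w ws H Hs]; simpl.
    + apply Derivable0; intros; constructor.
    + apply (Derivable2 _ _ _ _ _ _ _ _ _ (eval_Derivable _ _ _ H)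
               (evals_Derivable _ _ _ Hs)); intros; econstructor; eauto.
Qed.

Lemma eval_fun c v y : eval c v y -> forall y', eval c v y' -> y = y'
with evals_fun gs v ws : evals gs v ws -> forall ws', evals gs v ws' -> ws = ws'.
Proof.
  - intros H; destruct H as [v | x v | i v Hi | f gs v ws y Hs H | f g v y H
      | f g n v y z H1 H2 | f v n H Hm]; intros y' H'; inversion H'; subst; auto.
    + match goal with E : evals _ _ ?w |- _ =>
        rewrite <- (evals_fun _ _ _ Hs w E) in * end.
      eapply eval_fun; eauto.
    + eapply eval_fun; eauto.
    + match goal with E : eval (CPrec f g) _ ?w |- _ =>
        rewrite <- (eval_fun _ _ _ H1 w E) in * end.
      eapply eval_fun; eauto.
    + destruct (Nat.lt_trichotomy n y') as [L|[E|L]]; [exfalso | exact E | exfalso].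
      * match goal with Hl : forall m, m < y' -> _ |- _ =>
          destruct (Hl n L) as [k Hk] end.
        discriminate (eval_fun _ _ _ H _ Hk).
      * destruct (Hm y' L) as [k Hk].
        match goal with E : eval f (y' :: v) 0 |- _ =>
          discriminate (eval_fun _ _ _ Hk _ E) end.
  - intros H; destruct H as [v | g gs v w ws H Hs]; intros ws' H'; inversion H'; subst;
      f_equal; eauto.
Qed.

(** * An undecidable recursively enumerable set *)

(** This makes the bounded searches in [justb] exhaustive: a claim in the set coded by [s] is below
    [s], and so are the numbers it is paired from. *)
Lemma testbit_lt s x : Nat.testbit s x = true -> x < s.
Proof.
  intros H; destruct (Nat.lt_ge_cases x s) as [L|L]; [exact L|].
  pose proof (Nat.pow_gt_lin_r 2 x ltac:(lia)) as Hp.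
  rewrite Nat.testbit_true, Nat.div_small in H by lia; discriminate.
Qed.

Lemma finite_set_code (l : list nat) :
  exists s, forall x, Nat.testbit s x = true <-> In x l.
Proof.
  induction l as [|a l [s Hs]].
  - exists 0; intros x; rewrite Nat.bits_0; split; [discriminate | intros []].
  - exists (Nat.setbit s a); intros x.
    rewrite Nat.setbit_eqb, orb_true_iff, Nat.eqb_eq, Hs; reflexivity.
Qed.

(** * Checking derivations that are coded as bit sets *)

Definition mem (s k c v y : nat) : bool := Nat.testbit s (claim k c v y).

(** The disjuncts are the rules of [Just] in their order. Witnesses are sought below [s] and stages
    below [k], which loses nothing if the claim itself is in [s]. *)
Definition justb (s k c v y : nat) : bool :=
  (c =? cpair 0 0) && (y =? 0)
  || (c =? cpair 1 0) && exb s (fun x => exb s (fun l => (v =? lcons x l) && (y =? S x)))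
  || (c =? cpair 2 0) && exb s (fun l => v =? lcons y l)
  || exb s (fun i => (c =? cpair 2 (S i)) && exb s (fun x => exb s (fun l =>
       (v =? lcons x l) && exb k (fun k1 => mem s k1 (cpair 2 i) l y))))
  || exb s (fun f => exb s (fun gs => (c =? cpair 3 (cpair f gs)) && exb s (fun ws =>
       exb k (fun k1 => mem s k1 (cpair 6 gs) v ws) && exb k (fun k2 => mem s k2 f ws y))))
  || exb s (fun f => exb s (fun g => (c =? cpair 4 (cpair f g)) && exb s (fun l =>
       (v =? lcons 0 l) && exb k (fun k1 => mem s k1 f l y))))
  || exb s (fun f => exb s (fun g => (c =? cpair 4 (cpair f g)) && exb s (fun n => exb s (fun l =>
       (v =? lcons (S n) l) && exb s (fun z =>
         exb k (fun k1 => mem s k1 c (lcons n l) z) &&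
         exb k (fun k2 => mem s k2 g (lcons n (lcons z l)) y))))))
  || exb s (fun f => (c =? cpair 5 f) && exb k (fun k1 => mem s k1 f (lcons y v) 0) &&
       allb y (fun m => exb s (fun w => exb k (fun k2 => mem s k2 f (lcons m v) (S w)))))
  || (c =? cpair 6 0) && (y =? 0)
  || exb s (fun g => exb s (fun gs => (c =? cpair 6 (lcons g gs)) && exb s (fun w => exb s (fun ws =>
       (y =? lcons w ws) && exb k (fun k1 => mem s k1 g v w) &&
       exb k (fun k2 => mem s k2 (cpair 6 gs) v ws))))).

Ltac bools :=
  repeat match goal with
  | H : _ && _ = true |- _ => apply andb_true_iff in H; destruct H
  | H : exb _ _ = true |- _ => apply exb_true in H; destruct H as [? [? ?]]
  | H : (_ =? _) = true |- _ => apply Nat.eqb_eq in H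
  end; subst.

Ltac bounds :=
  unfold mem in *;
  repeat match goal with
  | H : Nat.testbit _ _ = true |- _ => apply testbit_lt in H
  end;
  unfold claim, lcons in *;
  repeat match goal with
  | H : context [cpair ?x ?y] |- _ =>
      lazymatch goal with
      | _ : x + y <= cpair x y |- _ => fail
      | _ => pose proof (cpair_ge x y)
      end
  end; lia.

Ltac exw x := apply exb_true; exists x; split; [bounds|].

Lemma justb_spec s k c v y :
  mem s k c v y = true ->
  justb s k c v y = true <-> Just (fun x => Nat.testbit s x = true) k c v y.
Proof.
  intros Hs; unfold justb; split.
  - intros H; rewrite !orb_true_iff in H.
    destruct H as [[[[[[[[[H|H]|H]|H]|H]|H]|H]|H]|H]|H]; bools.
    + constructor.
    + constructor.
    + constructor.
    + econstructor; eassumption.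
    + econstructor; eassumption.
    + econstructor; eassumption.
    + eapply J_precS; eassumption.
    + eapply J_mu; [eassumption | assumption |].
      intros m Hm; rewrite allb_true in *.
      match goal with H : forall i, i < y -> _ |- _ => specialize (H m Hm) end.
      bools; eauto.
    + constructor.
    + econstructor; eassumption.
  - intros J; rewrite !orb_true_iff; destruct J.
    + do 9 left; rewrite !Nat.eqb_refl; reflexivity.
    + do 8 left; right; rewrite Nat.eqb_refl; exw x; exw v; rewrite !Nat.eqb_refl; reflexivity.
    + do 7 left; right; rewrite Nat.eqb_refl; exw v; apply Nat.eqb_refl.
    + do 6 left; right; exw i; rewrite Nat.eqb_refl; exw x; exw v.
      rewrite Nat.eqb_refl; exw k1; assumption.
    + do 5 left; right; exw f; exw gs; rewrite Nat.eqb_refl; exw ws.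
      apply andb_true_iff; split; [exw k1 | exw k2]; assumption.
    + do 4 left; right; exw f; exw g; rewrite Nat.eqb_refl; exw v.
      rewrite Nat.eqb_refl; exw k1; assumption.
    + do 3 left; right; exw f; exw g; rewrite Nat.eqb_refl; exw n; exw v.
      rewrite Nat.eqb_refl; exw y.
      apply andb_true_iff; split; [exw k1 | exw k2]; assumption.
    + do 2 left; right; exw f; rewrite Nat.eqb_refl.
      apply andb_true_iff; split; [exw k1; assumption|].
      apply allb_true; intros m Hm.
      match goal with H : forall m, m < n -> _ |- _ =>
        destruct (H m Hm) as [k2 [w [? ?]]] end.
      exw w; exw k2; assumption.
    + left; right; rewrite !Nat.eqb_refl; reflexivity.
    + right; exw g; exw gs; rewrite Nat.eqb_refl; exw w; exw ws.
      rewrite Nat.eqb_refl; apply andb_true_iff; split; [exw k1 | exw k2]; assumption.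
Qed.

(* [s] certifies that program [e] outputs 1 on input [e]. *)
Definition cert (e s : nat) : bool :=
  allb s (fun k => allb s (fun c => allb s (fun v => allb s (fun y =>
    if mem s k c v y then justb s k c v y else true)))) &&
  exb s (fun k => mem s k e (lcons e 0) 1).

Lemma recursive2_cert : recursive2 (fun e s => Nat.b2n (cert e s)).
Proof.
  apply recursive2_intro; unfold cert, justb, mem, claim, lcons; rec.
Qed.

Lemma cert_spec c : (exists s, cert (num c) s = true) <-> eval c [num c] 1.
Proof.
  split.
  - intros [s Hs]; unfold cert in Hs; bools.
    assert (HC : Closed (fun x => Nat.testbit s x = true)).
    { intros k c' v y Hm; apply justb_spec; [exact Hm|].
      change (mem s k c' v y = true) in Hm.
      rewrite allb_true in H; specialize (H k ltac:(bounds)).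
      rewrite allb_true in H; specialize (H c' ltac:(bounds)).
      rewrite allb_true in H; specialize (H v ltac:(bounds)).
      rewrite allb_true in H; specialize (H y ltac:(bounds)).
      rewrite Hm in H; exact H. }
    eapply (proj1 (Closed_sound _ HC _)); eassumption.
  - intros H; apply eval_Derivable in H; destruct H as [l [k [HC HI]]].
    destruct (finite_set_code l) as [s Hs]; exists s.
    unfold cert; apply andb_true_iff; split.
    + do 4 (apply allb_true; intros ? _).
      match goal with |- (if ?b then _ else _) = true => destruct b eqn:E end;
        [|reflexivity].
      apply justb_spec; [exact E|].
      apply Hs, HC in E; revert E; apply Just_mono; intros x; apply Hs.
    + apply Hs in HI. change (mem s k (num c) (lcons (num c) 0) 1 = true) in HI.
      exw k; exact HI.
Qed.

(** Diagonalisation: let [c] compute the negation of [d]. On its own number it outputs 1 iff [d]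
    rejects that number, whereas by [cert_spec] it outputs 1 iff a certificate exists. *)
Lemma cert_undecidable (d : nat -> bool) :
  recursive1 (fun e => Nat.b2n (d e)) ->
  (forall e, d e = true <-> exists s, cert e s = true) -> False.
Proof.
  intros Hd Hspec.
  assert (Hn : recursive1 (fun e => Nat.b2n (negb (d e)))).
  { apply recursive1_intro; apply Rec_negb; apply (Rec_app1 _ _ _ Hd).
    apply Rec_proj; lia. }
  destruct Hn as [c Hc]; specialize (Hc (num c)); specialize (Hspec (num c)).
  rewrite cert_spec in Hspec.
  destruct (d (num c)); simpl in Hc.
  - discriminate (eval_fun _ _ _ Hc _ (proj1 Hspec eq_refl)).
  - discriminate (proj2 Hspec Hc).
Qed.

(** * The family and an HCEGIS engine for it *)

#[global] Hint Resolve recursive2_cert : recdb.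

Definition par_q (z : nat) : nat := pi1 z.
Definition par_k (z : nat) : nat := pi1 (pi2 z).
Definition par_r (z : nat) : nat := pi1 (pi2 (pi2 z)).
Definition par_e (z : nat) : nat := pi1 (pi2 (pi2 (pi2 z))).

Definition firstb (e s : nat) : bool :=
  cert e s && allb s (fun s0 => negb (cert e s0)).

Definition promoted (i : nat) : bool :=
  (2 <=? pi2 i) && firstb (par_e (pi1 i)) (pi2 i - 2).

(** A promoted language carries the label of its base language, so the label does not tell the two
    apart. *)
Definition label (i : nat) : nat := if promoted i then cpair (pi1 i) 1 else i.

(* With [a n = 4n], [e n = 4n+1], [q n = 4n+2], [p n = 4n+3], and [z] read as
   parameters [(q, k, r, e, _)]:
   - [cpair z 0] is [{a n | all n}], all [e n] and [q z];
   - [cpair z 1] is [{a n | n < k}], all [e n], [q q] and the label [p (cpair z 1)];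
   - [cpair z (s+2)] is [{a n | n < k+1+r}], all [e n], [q q] and its own label, or the
     label of [cpair z 1] if [s] is the least certificate for the program [e]. *)
Definition fam (i : nat) : lang := fun x =>
  if x mod 4 =? 0 then
    (pi2 i =? 0) ||
    (x / 4 <? par_k (pi1 i) + (if pi2 i =? 1 then 0 else S (par_r (pi1 i))))
  else if x mod 4 =? 1 then true
  else if x mod 4 =? 2 then
    x / 4 =? (if pi2 i =? 0 then pi1 i else par_q (pi1 i))
  else negb (pi2 i =? 0) && (x / 4 =? label i).

Lemma recursive2_firstb : recursive2 (fun e s => Nat.b2n (firstb e s)).
Proof. apply recursive2_intro; unfold firstb; rec. Qed.
#[global] Hint Resolve recursive2_firstb : recdb.

Lemma recursive1_label : recursive1 label.
Proof. apply recursive1_intro; unfold label, promoted, par_e; rec. Qed.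
#[global] Hint Resolve recursive1_label : recdb.

Lemma recursive2_fam : recursive2 (fun i x => Nat.b2n (fam i x)).
Proof. apply recursive2_intro; unfold fam, par_k, par_r, par_q; rec. Qed.
#[global] Hint Resolve recursive2_fam : recdb.

Lemma div4 n t : t < 4 -> (4 * n + t) / 4 = n.
Proof. intros H; symmetry; apply Nat.div_unique with t; lia. Qed.

Lemma mod4 n t : t < 4 -> (4 * n + t) mod 4 = t.
Proof. intros H; symmetry; apply Nat.mod_unique with n; lia. Qed.

Lemma fam_a z m n : fam (cpair z m) (4 * n + 0) =
  (m =? 0) || (n <? par_k z + (if m =? 1 then 0 else S (par_r z))).
Proof. unfold fam; rewrite div4, mod4, pi1_cpair, pi2_cpair by lia; reflexivity. Qed.

Lemma fam_e i n : fam i (4 * n + 1) = true.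
Proof. unfold fam; rewrite mod4 by lia; reflexivity. Qed.

Lemma fam_q z m n : fam (cpair z m) (4 * n + 2) = (n =? if m =? 0 then z else par_q z).
Proof. unfold fam; rewrite div4, mod4, pi1_cpair, pi2_cpair by lia; reflexivity. Qed.

Lemma fam_p z m n :
  fam (cpair z m) (4 * n + 3) = negb (m =? 0) && (n =? label (cpair z m)).
Proof. unfold fam; rewrite div4, mod4, pi1_cpair, pi2_cpair by lia; reflexivity. Qed.

Lemma elem_cases x : exists n,
  x = 4 * n + 0 \/ x = 4 * n + 1 \/ x = 4 * n + 2 \/ x = 4 * n + 3.
Proof.
  exists (x / 4); pose proof (Nat.div_mod_eq x 4).
  pose proof (Nat.mod_upper_bound x 4 ltac:(lia)); lia.
Qed.

Lemma index_cases i : exists z m, i = cpair z m.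
Proof. exists (pi1 i), (pi2 i); symmetry; apply cpair_pi. Qed.

Lemma promoted_base z : promoted (cpair z 1) = false.
Proof. unfold promoted; rewrite pi2_cpair; reflexivity. Qed.

Lemma promoted_query z s : promoted (cpair z (S (S s))) = firstb (par_e z) s.
Proof.
  unfold promoted; rewrite pi1_cpair, pi2_cpair.
  replace (S (S s) - 2) with s by lia; reflexivity.
Qed.

Lemma label_base z : label (cpair z 1) = cpair z 1.
Proof. unfold label; rewrite promoted_base; reflexivity. Qed.

Lemma firstb_spec e s :
  firstb e s = true <-> cert e s = true /\ forall s0, s0 < s -> cert e s0 = false.
Proof.
  unfold firstb; rewrite andb_true_iff, allb_true.
  setoid_rewrite negb_true_iff; reflexivity.
Qed.

Lemma firstb_unique e s s' : firstb e s = true -> firstb e s' = true -> s = s'.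
Proof.
  rewrite !firstb_spec; intros [H1 H2] [H1' H2'].
  destruct (Nat.lt_trichotomy s s') as [L|[E|L]]; [|exact E|].
  - rewrite (H2' _ L) in H1; discriminate.
  - rewrite (H2 _ L) in H1'; discriminate.
Qed.

(** The value [w] signals that no number below [w] satisfies [p]; the engine then uses it as its
    next query. *)
Fixpoint least (p : nat -> bool) (w : nat) : nat :=
  match w with
  | 0 => 0
  | S w' => if p 0 then 0 else S (least (fun s => p (S s)) w')
  end.

Lemma least_le p w : least p w <= w.
Proof.
  revert p; induction w as [|w IH]; intros p; simpl; [lia|].
  destruct (p 0); [lia|]; specialize (IH (fun s => p (S s))); lia.
Qed.

Lemma least_true p w : least p w < w -> p (least p w) = true.
Proof.
  revert p; induction w as [|w IH]; intros p; simpl; [lia|].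
  destruct (p 0) eqn:E; intros H; [exact E|].
  apply (IH (fun s => p (S s))); lia.
Qed.

Lemma least_min p w s : s < least p w -> p s = false.
Proof.
  revert p s; induction w as [|w IH]; intros p s; simpl; [lia|].
  destruct (p 0) eqn:E; [lia|]; destruct s as [|s]; intros H; [exact E|].
  apply (IH (fun s => p (S s))); lia.
Qed.

Definition next (e w : nat) : nat := least (cert e) w.

Lemma recursive2_next : recursive2 next.
Proof.
  apply recursive2_intro; unfold next.
  apply Rec_min with (fun v s => cert (nth 0 v 0) s || (nth 1 v 0 <=? s)).
  - rec.
  - intros v _; apply orb_true_iff; rewrite Nat.leb_le.
    pose proof (least_le (cert (nth 0 v 0)) (nth 1 v 0)).
    destruct (Nat.eq_dec (least (cert (nth 0 v 0)) (nth 1 v 0)) (nth 1 v 0)); [lia|].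
    left; apply least_true; lia.
  - intros v m _ Hm; apply orb_false_iff; rewrite Nat.leb_gt.
    pose proof (least_le (cert (nth 0 v 0)) (nth 1 v 0)).
    split; [exact (least_min _ _ _ Hm) | lia].
Qed.
#[global] Hint Resolve recursive2_next : recdb.

(** Until a label is seen the engine follows the elements [4 * n + 2]. The label of some [cpair z 1]
    starts the queries at [cpair z 2]. A counterexample divisible by 4 can only mean that the target
    is the base language. After any other one the next query is the least certificate below a bound
    exceeding the old query number and the datum, or else that bound. *)
Definition hengine_num (p x y : nat) : nat :=
  if pi2 p =? 0 then
    if x =? 0 then p
    else if (x - 1) mod 4 =? 2 then cpair ((x - 1) / 4) 0
    else if (x - 1) mod 4 =? 3 then
      if pi2 ((x - 1) / 4) =? 1 then cpair (pi1 ((x - 1) / 4)) 2 else (x - 1) / 4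
    else p
  else if pi2 p =? 1 then p
  else if y =? 0 then p
  else if (y - 1) mod 4 =? 0 then cpair (pi1 p) 1
  else cpair (pi1 p) (S (S (next (par_e (pi1 p)) (pi2 p - 2 + x + 1)))).

Definition hengine (p : nat) (a b : option nat) : nat := hengine_num p (enc a) (enc b).

Lemma hengine_recursive : engine_recursive hengine.
Proof.
  assert (H : recursive3 hengine_num).
  { apply recursive3_intro; unfold hengine_num, par_e; rec. }
  destruct H as [c Hc]; exists c; intros p a b; apply Hc.
Qed.

Lemma hengine_J z a b : hengine (cpair z 0) a b =
  match a with
  | None => cpair z 0
  | Some x =>
      if x mod 4 =? 2 then cpair (x / 4) 0
      else if x mod 4 =? 3 then
        if pi2 (x / 4) =? 1 then cpair (pi1 (x / 4)) 2 else x / 4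
      else cpair z 0
  end.
Proof.
  unfold hengine, hengine_num; rewrite pi2_cpair; destruct a as [x|]; [|reflexivity].
  unfold enc; replace (S x - 1) with x by lia; reflexivity.
Qed.

Lemma hengine_base z a b : hengine (cpair z 1) a b = cpair z 1.
Proof. unfold hengine, hengine_num; rewrite pi2_cpair; reflexivity. Qed.

Lemma hengine_query z s a b : hengine (cpair z (S (S s))) a b =
  match b with
  | None => cpair z (S (S s))
  | Some y =>
      if y mod 4 =? 0 then cpair z 1
      else cpair z (S (S (next (par_e z) (s + enc a + 1))))
  end.
Proof.
  unfold hengine, hengine_num; rewrite pi1_cpair, pi2_cpair; destruct b as [y|]; [|reflexivity].
  change (enc (Some y)) with (S y); replace (S y - 1) with y by lia.
  replace (S (S s) - 2) with s by lia; reflexivity.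
Qed.

Lemma fam_nonempty i : exists n, fam i n = true.
Proof. exists (4 * 0 + 1); apply fam_e. Qed.

(** * Convergence of the HCEGIS engine *)

Section HCEGIS.

Variables (i : nat) (tau cex : nat -> option nat).
Hypothesis Htau : is_trace (fam i) tau.
Let h := hyp hengine (cpair 0 0) tau cex.
Hypothesis Hcex : forall n, hcheck_ok (fam i) (fam (h n)) tau n (cex n).

Lemma h_step n : h (S n) = hengine (h n) (tau n) (cex n).
Proof. reflexivity. Qed.

Lemma shown n x : tau n = Some x -> fam i x = true.
Proof. intros H; apply Htau; eauto. Qed.

(** There is no legal counterexample to the target itself, and without one only data outside the
    target could lead to another hypothesis. *)
Lemma stays_at_target n : h n = i -> forall k, h (n + k) = i.
Proof.
  intros Hn k; induction k as [|k IH]; [rewrite Nat.add_0_r; exact Hn|].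
  rewrite Nat.add_succ_r, h_step, IH.
  pose proof (Hcex (n + k)) as Hc; rewrite IH in Hc.
  destruct (cex (n + k)) as [c|]; simpl in Hc; [destruct Hc as [? [? _]]; congruence|].
  clear Hc; destruct (index_cases i) as [z [m Ei]]; rewrite Ei; destruct m as [|[|s]].
  - rewrite hengine_J; destruct (tau (n + k)) as [x|] eqn:E; [|reflexivity].
    apply shown in E; rewrite Ei in E; destruct (elem_cases x) as [y [->|[->|[->| ->]]]];
      rewrite div4, mod4 by lia; try reflexivity.
    + rewrite fam_q in E; apply Nat.eqb_eq in E; subst; reflexivity.
    + rewrite fam_p in E; discriminate.
  - apply hengine_base.
  - apply (hengine_query z s).
Qed.

Lemma converges_when_reached n : h n = i -> converges_to h i.
Proof.
  intros Hn; exists n; intros k Hk.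
  replace k with (n + (k - n)) by lia; apply stays_at_target; exact Hn.
Qed.

Lemma before_label n :
  (forall k x, k < n -> tau k = Some x -> x mod 4 <> 3) -> exists q, h n = cpair q 0.
Proof.
  induction n as [|n IH]; intros H; [exists 0; reflexivity|].
  destruct IH as [q Hq]; [intros k x Hk; apply H; lia|].
  rewrite h_step, Hq, hengine_J.
  destruct (tau n) as [x|] eqn:E; [|eauto].
  specialize (H n x (le_n _) E).
  destruct (x mod 4 =? 2); [eauto|].
  destruct (Nat.eqb_spec (x mod 4) 3); [contradiction | eauto].
Qed.

Lemma reach_J z : i = cpair z 0 -> exists n, h n = i.
Proof.
  intros Ei.
  assert (Hq : fam i (4 * z + 2) = true) by (rewrite Ei, fam_q; apply Nat.eqb_refl).
  apply Htau in Hq; destruct Hq as [k Hk]; exists (S k).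
  destruct (before_label k) as [q Hq].
  - intros j x _ Hj H3; apply shown in Hj; rewrite Ei in Hj.
    destruct (elem_cases x) as [y [->|[->|[->| ->]]]]; rewrite mod4 in H3 by lia;
      try discriminate.
    rewrite fam_p in Hj; discriminate.
  - rewrite h_step, Hq, hengine_J, Hk, mod4, div4 by lia; symmetry; exact Ei.
Qed.

(** Every label in the trace is that of the target. When the first one is shown the engine is still
    at some [cpair q 0], where it reacts to labels. *)
Lemma label_shown : pi2 i <> 0 -> exists k, tau k = Some (4 * label i + 3) /\
  h (S k) = if pi2 (label i) =? 1 then cpair (pi1 (label i)) 2 else label i.
Proof.
  intros H0.
  assert (Hp : forall x, fam i x = true -> x mod 4 = 3 -> x = 4 * label i + 3).
  { intros x Hx H3; rewrite <- (cpair_pi i) in Hx.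
    destruct (elem_cases x) as [y [->|[->|[->| ->]]]]; rewrite mod4 in H3 by lia;
      try discriminate.
    rewrite fam_p, cpair_pi in Hx; apply andb_true_iff in Hx.
    destruct Hx as [_ Hx]; apply Nat.eqb_eq in Hx; congruence. }
  assert (Hl : exists k, tau k = Some (4 * label i + 3)).
  { apply Htau; rewrite <- (cpair_pi i) at 1; rewrite fam_p, cpair_pi, Nat.eqb_refl.
    destruct (pi2 i); [contradiction | reflexivity]. }
  destruct Hl as [k Hk]; revert Hk; induction k as [k IH] using lt_wf_ind; intros Hk.
  destruct (exb k (fun j => match tau j with Some x => x mod 4 =? 3 | None => false end))
    eqn:E.
  - apply exb_true in E; destruct E as [j [Hj E]].
    destruct (tau j) as [x|] eqn:Ej; [|discriminate].
    apply (IH j Hj); rewrite Ej; f_equal; apply Hp;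
      [exact (shown _ _ Ej) | apply Nat.eqb_eq; exact E].
  - exists k; split; [exact Hk|].
    destruct (before_label k) as [q Hq].
    + intros j x Hj Ej H3; apply not_true_iff_false in E; apply E.
      apply exb_true; exists j; split; [exact Hj|]; rewrite Ej; apply Nat.eqb_eq; exact H3.
    + rewrite h_step, Hq, hengine_J, Hk, mod4, div4 by lia; reflexivity.
Qed.

Lemma trace_bound k : exists M, forall j x, j <= k -> tau j = Some x -> x <= M.
Proof.
  induction k as [|k [M IH]].
  - exists (enc (tau 0)); intros j x Hj E; replace j with 0 in E by lia.
    rewrite E; simpl; lia.
  - exists (M + enc (tau (S k))); intros j x Hj E.
    destruct (Nat.eq_dec j (S k)) as [->|]; [rewrite E; simpl; lia|].
    specialize (IH j x ltac:(lia) E); lia.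
Qed.

(* Once the label has been shown, the elements separating the two bounds are small
   enough for the verifier, so it cannot answer [None]. *)
Lemma query_step_base z n k s :
  i = cpair z 1 -> tau k = Some (4 * cpair z 1 + 3) -> k < n -> h n = cpair z (S (S s)) ->
  h (S n) = cpair z 1 \/
  firstb (par_e z) s = false /\
  h (S n) = cpair z (S (S (next (par_e z) (s + enc (tau n) + 1)))) /\
  exists j x, j < n /\ tau j = Some x /\ cpair z (S (S s)) < x.
Proof.
  intros Ei Hk Hkn Hn; pose proof (Hcex n) as Hc; rewrite Hn, Ei in Hc.
  rewrite h_step, Hn, hengine_query.
  destruct (cex n) as [c|]; simpl in Hc.
  - destruct Hc as [H1 [H2 [j [t [Hj [Ht Hct]]]]]].
    destruct (elem_cases c) as [y [->|[->|[->| ->]]]]; rewrite mod4 by lia.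
    + left; reflexivity.
    + rewrite fam_e in H2; discriminate.
    + rewrite fam_q in H1; rewrite fam_q in H2; simpl in H1, H2; congruence.
    + right; rewrite fam_p in H1; rewrite fam_p, label_base in H2.
      simpl in H1, H2; apply Nat.eqb_eq in H1; unfold label in H1.
      rewrite promoted_query in H1.
      destruct (firstb (par_e z) s).
      * rewrite pi1_cpair in H1; apply Nat.eqb_neq in H2; contradiction.
      * split; [reflexivity|]; split; [reflexivity|].
        exists j, t; split; [exact Hj|]; split; [exact Ht|]; simpl in *; lia.
  (* The witness separates the query from the base language and is below the shown label, since
     [par_k z] is at most [z]. *)
  - exfalso; apply Hc; exists (4 * par_k z + 0), k, (4 * cpair z 1 + 3).
    split; [exact Hkn|]; split; [exact Hk|]; split; [|split].
    + pose proof (cpair_ge z 1); pose proof (cpair_ge (pi1 z) (pi2 z)).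
      pose proof (cpair_ge (pi1 (pi2 z)) (pi2 (pi2 z))).
      rewrite !cpair_pi in *; unfold par_k; lia.
    + rewrite fam_a; simpl; apply Nat.ltb_lt; lia.
    + rewrite fam_a; simpl; apply Nat.ltb_ge; lia.
Qed.

Lemma reach_base z : i = cpair z 1 -> exists n, h n = i.
Proof.
  intros Ei; destruct label_shown as [k [Hk Hs]]; [rewrite Ei, pi2_cpair; discriminate|].
  rewrite Ei, label_base in Hk, Hs; rewrite pi1_cpair, pi2_cpair in Hs; simpl in Hs.
  (* Unless the base is reached, either [s] is the least certificate, so that the query shares the
     label of the base, or [s] bounds both the number [t] of steps and the data shown after time
     [k]. *)
  assert (Inv : forall t, (exists n, h n = cpair z 1) \/
    exists s, h (S k + t) = cpair z (S (S s)) /\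
      (forall s0, s0 < s -> cert (par_e z) s0 = false) /\
      (cert (par_e z) s = true \/
       t <= s /\ forall j x, k < j < S k + t -> tau j = Some x -> x <= s)).
  { induction t as [|t IH].
    - right; exists 0; rewrite Nat.add_0_r; split; [exact Hs|].
      split; [intros; lia|]; right; split; [lia | intros; lia].
    - destruct IH as [|[s [Hn [Hlt Hor]]]]; [left; assumption|].
      destruct (query_step_base z (S k + t) k s Ei Hk ltac:(lia) Hn)
        as [E|[Hf [E _]]]; [left; eauto|].
      right; rewrite Nat.add_succ_r, E.
      assert (Hcs : cert (par_e z) s = false).
      { destruct (cert (par_e z) s) eqn:Ec; [|reflexivity].
        rewrite (proj2 (firstb_spec _ _) (conj Ec Hlt)) in Hf; discriminate. }
      destruct Hor as [Hor|[Hts Hb]]; [congruence|].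
      set (w := s + enc (tau (S k + t)) + 1).
      exists (next (par_e z) w); split; [reflexivity|].
      split; [intros s0; apply least_min|].
      destruct (Nat.lt_ge_cases (next (par_e z) w) w) as [L|L].
      + left; apply least_true; exact L.
      + right; assert (Ew : next (par_e z) w = w)
          by (pose proof (least_le (cert (par_e z)) w); unfold next in *; lia).
        rewrite Ew; split; [unfold w; lia|]; intros j x Hj Ej.
        destruct (Nat.eq_dec j (S k + t)) as [->|].
        * unfold w; rewrite Ej; simpl; lia.
        * specialize (Hb j x ltac:(lia) Ej); unfold w; lia. }
  (* [M] bounds the data up to time [k]; after [M] further steps the own label of an uncertified
     query exceeds all data and is no longer a legal answer. *)
  rewrite Ei; destruct (trace_bound k) as [M HM].
  destruct (Inv M) as [|[s [Hn [Hlt Hor]]]]; [assumption|].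
  destruct (query_step_base z (S k + M) k s Ei Hk ltac:(lia) Hn)
    as [E|[Hf [_ [j [x [Hj [Ej Hx]]]]]]]; [eauto|]; exfalso.
  destruct Hor as [Hc|[HMs Hb]].
  - rewrite (proj2 (firstb_spec _ _) (conj Hc Hlt)) in Hf; discriminate.
  - pose proof (cpair_ge z (S (S s))).
    destruct (Nat.le_gt_cases j k) as [L|L];
      [specialize (HM j x L Ej) | specialize (Hb j x ltac:(lia) Ej)]; lia.
Qed.

(** The label of the query is outside the target. The elements [4 * n + 1], common to all languages,
    supply a datum larger than it, and from then on [None] is illegal. *)
Lemma query_leaves z s s' n :
  i = cpair z (S (S s')) -> firstb (par_e z) s' = true -> s < s' -> h n = cpair z (S (S s)) ->
  exists n', h n' = cpair z (S (S s)) /\ exists c, cex n' = Some c.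
Proof.
  intros Ei Hs' Hss' Hn.
  set (x := 4 * cpair z (S (S s)) + 3).
  assert (Hx1 : fam (cpair z (S (S s))) x = true /\ fam i x = false).
  { unfold x; rewrite Ei, !fam_p; unfold label; rewrite !promoted_query, Hs'.
    assert (E : firstb (par_e z) s = false).
    { apply not_true_iff_false; intros E.
      rewrite (firstb_unique _ _ _ E Hs') in Hss'; lia. }
    rewrite E, Nat.eqb_refl, pi1_cpair; split; [reflexivity|]; simpl.
    apply Nat.eqb_neq; intros Ep; apply cpair_inj in Ep; lia. }
  destruct (proj1 (Htau (4 * x + 1)) (fam_e i x)) as [j Hj].
  assert (H : forall d m, h m = cpair z (S (S s)) -> j < m + d ->
    exists n', h n' = cpair z (S (S s)) /\ exists c, cex n' = Some c).
  { induction d as [|d IH]; intros m Hm Hd;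
      (destruct (cex m) as [c|] eqn:Ec; [eauto|]).
    - exfalso; pose proof (Hcex m) as Hc; rewrite Ec, Hm in Hc; apply Hc.
      exists x, j, (4 * x + 1); repeat split; try tauto; lia.
    - apply (IH (S m)); [|lia].
      rewrite h_step, Hm, Ec; apply (hengine_query z s). }
  apply (H (S j) n Hn); lia.
Qed.

(** All queries for one [z] agree on the multiples of 4, so no counterexample sends the engine to
    the base. The query number increases and cannot jump over the least certificate [s'], at which
    [next] stops. *)
Lemma reach_promoted z s' :
  i = cpair z (S (S s')) -> firstb (par_e z) s' = true -> exists n, h n = i.
Proof.
  intros Ei Hs'; destruct label_shown as [k [_ Hs]]; [rewrite Ei, pi2_cpair; discriminate|].
  assert (El : label i = cpair z 1)
    by (rewrite Ei; unfold label; rewrite promoted_query, Hs', pi1_cpair; reflexivity).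
  rewrite El, pi1_cpair, pi2_cpair in Hs; simpl in Hs.
  assert (H : forall d n s, s + d = s' -> h n = cpair z (S (S s)) -> exists n, h n = i).
  { induction d as [d IH] using lt_wf_ind; intros n s Hd Hn.
    destruct (Nat.eq_dec s s') as [->|]; [exists n; congruence|].
    destruct (query_leaves z s s' n Ei Hs' ltac:(lia) Hn) as [n' [Hn' [c Hc]]].
    pose proof (h_step n') as E; rewrite Hn', hengine_query, Hc in E.
    pose proof (Hcex n') as Hok; rewrite Hc, Hn', Ei in Hok; destruct Hok as [H1 [H2 _]].
    set (w := s + enc (tau n') + 1) in *.
    apply firstb_spec in Hs'; destruct Hs' as [Hc' Hl'].
    assert (Hle : next (par_e z) w <= s').
    { destruct (Nat.le_gt_cases (next (par_e z) w) s') as [L|L]; [exact L|].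
      apply least_min in L; congruence. }
    assert (Hgt : s < next (par_e z) w).
    { destruct (Nat.lt_ge_cases (next (par_e z) w) w) as [L|L]; [|unfold w in *; lia].
      apply least_true in L.
      destruct (Nat.le_gt_cases s' (next (par_e z) w)) as [L'|L']; [lia|].
      apply Hl' in L'; unfold next in L'; congruence. }
    destruct (Nat.eqb_spec (c mod 4) 0) as [E0|_].
    - destruct (elem_cases c) as [y [->|[->|[->| ->]]]]; rewrite mod4 in E0 by lia;
        try discriminate.
      rewrite fam_a in H1; rewrite fam_a in H2; simpl in H1, H2; congruence.
    - apply (IH (s' - next (par_e z) w)) with (S n') (next (par_e z) w); [lia | lia | exact E]. }
  apply (H s' (S k) 0); [lia | exact Hs].
Qed.

Lemma reach_target : exists n, h n = i.
Proof.
  destruct (index_cases i) as [z [[|[|s]] Ei]].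
  - exact (reach_J z Ei).
  - exact (reach_base z Ei).
  - destruct (firstb (par_e z) s) eqn:E; [exact (reach_promoted z s Ei E)|].
    destruct label_shown as [k [_ Hs]]; [rewrite Ei, pi2_cpair; discriminate|].
    assert (El : label i = i)
      by (unfold label; rewrite Ei, promoted_query, E; reflexivity).
    exists (S k); rewrite Hs, El, Ei, pi2_cpair; reflexivity.
Qed.

End HCEGIS.

Lemma fam_in_HCEGIS : in_HCEGIS fam.
Proof.
  exists hengine, (cpair 0 0); split; [exact hengine_recursive|].
  intros i tau cex Htau Hcex.
  destruct (reach_target i tau cex Htau Hcex) as [n Hn].
  exact (converges_when_reached i tau cex Htau Hcex n Hn).
Qed.

Lemma fam_indexed : indexed_family fam.
Proof. split; [exact fam_nonempty | exact recursive2_fam]. Qed.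

(** * No CEGIS engine identifies the family *)

Lemma functional_choice {A B : Type} (R : A -> B -> Prop) :
  (forall x, exists y, R x y) -> exists f, forall x, R x (f x).
Proof.
  intros H; exists (fun x => proj1_sig (constructive_indefinite_description _ (H x))).
  intros x; exact (proj2_sig (constructive_indefinite_description _ (H x))).
Qed.

(** * Runs against verifiers that answer by time and hypothesis *)

Fixpoint run (F : nat -> option nat -> option nat -> nat)
    (X : nat -> nat -> option nat) (tau : nat -> option nat) (p n : nat) : nat :=
  match n with
  | 0 => p
  | S k => F (run F X tau p k) (tau k) (X k (run F X tau p k))
  end.

Lemma hyp_run F X tau p n :
  hyp F p tau (fun k => X k (run F X tau p k)) n = run F X tau p n.
Proof. induction n as [|n IH]; simpl; [|rewrite IH]; reflexivity. Qed.

Lemma cegis_run L F p i X tau :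
  cegis_identifies L F p i -> is_trace (L i) tau ->
  (forall n, check_ok (L i) (L (run F X tau p n)) (X n (run F X tau p n))) ->
  converges_to (run F X tau p) i.
Proof.
  intros Hid Htau HX.
  destruct (Hid tau (fun k => X k (run F X tau p k)) Htau) as [N HN].
  - intros n; rewrite hyp_run; apply HX.
  - exists N; intros n Hn; rewrite <- hyp_run; auto.
Qed.

Definition text (M : lang) (n : nat) : option nat := if M n then Some n else None.

Lemma text_elem M n x : text M n = Some x -> x = n /\ M x = true.
Proof.
  unfold text; destruct (M n) eqn:E; [|discriminate]; intros H; injection H as <-; auto.
Qed.

Lemma text_trace M : is_trace M (text M).
Proof.
  intros n; split.
  - intros H; exists n; unfold text; rewrite H; reflexivity.
  - intros [k H]; apply (text_elem _ _ _ H).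
Qed.

Lemma check_ok_refl M : check_ok M M None.
Proof. intros m H; exact H. Qed.

(* Otherwise presenting [a] whenever the engine is at [i] keeps it from ever
   staying at [i], on a trace of [L i]. *)
Lemma cegis_lock L F p i a :
  cegis_identifies L F p i -> (forall x, a = Some x -> L i x = true) ->
  F i a None = i.
Proof.
  intros Hid Ha; destruct (Nat.eq_dec (F i a None) i) as [E|NE]; [exact E|exfalso].
  destruct (functional_choice (fun h c => check_ok (L i) (L h) c /\ (h = i -> c = None)))
    as [X HX].
  { intros h; destruct (classic (check_ok (L i) (L h) None)) as [Hn|Hn].
    - exists None; auto.
    - destruct (not_all_ex_not _ _ Hn) as [m Hm].
      apply imply_to_and in Hm; destruct Hm as [H1 H2].
      exists (Some m); split.
      + split; [exact H1 | apply not_true_is_false; exact H2].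
      + intros ->; contradiction. }
  (* The state is the hypothesis with the number of text elements used; a visit to [i] shows [a] and
     uses none. *)
  pose (st := fix st n : nat * nat := match n with
    | 0 => (p, 0)
    | S n => if fst (st n) =? i then (F i a None, snd (st n))
             else (F (fst (st n)) (text (L i) (snd (st n))) (X (fst (st n))), S (snd (st n)))
    end).
  pose (tau n := if fst (st n) =? i then a else text (L i) (snd (st n))).
  assert (Hrun : forall n, run F (fun _ => X) tau p n = fst (st n)).
  { induction n as [|n IH]; [reflexivity|]; simpl; rewrite IH; unfold tau.
    destruct (Nat.eqb_spec (fst (st n)) i) as [E|E]; [|reflexivity].
    rewrite E, (proj2 (HX i) eq_refl); reflexivity. }
  (* As [F i a None] differs from [i], no two consecutive hypotheses are [i]; hence the whole text
     gets shown. *)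
  assert (Hleave : forall n, exists n', snd (st n') = snd (st n) /\ fst (st n') <> i).
  { intros n; destruct (Nat.eq_dec (fst (st n)) i) as [E|E]; [|eauto].
    exists (S n); simpl; rewrite (proj2 (Nat.eqb_eq _ _) E); auto. }
  assert (Hcnt : forall k, exists n, snd (st n) = k /\ fst (st n) <> i).
  { induction k as [|k [n [H1 H2]]]; [exact (Hleave 0)|].
    destruct (Hleave (S n)) as [n' [H3 H4]]; exists n'; split; [|exact H4].
    rewrite H3; simpl; rewrite (proj2 (Nat.eqb_neq _ _) H2); simpl; congruence. }
  destruct (cegis_run L F p i (fun _ => X) tau Hid) as [N HN].
  - intros x; split.
    + intros Hx; destruct (Hcnt x) as [n [H1 H2]]; exists n; unfold tau.
      rewrite (proj2 (Nat.eqb_neq _ _) H2), H1; unfold text; rewrite Hx; reflexivity.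
    + intros [n Hn]; unfold tau in Hn; destruct (fst (st n) =? i); [auto|].
      exact (proj2 (text_elem _ _ _ Hn)).
  - intros n; apply HX.
  - apply NE; rewrite <- (HN (S N)) at 2 by lia; rewrite Hrun; simpl.
    rewrite <- Hrun, HN, Nat.eqb_refl by lia; reflexivity.
Qed.

Definition join {A : Type} (n0 : nat) (f g : nat -> A) (n : nat) : A :=
  if n <? n0 then f n else g (n - n0).

Lemma join_lt {A} n0 (f g : nat -> A) n : n < n0 -> join n0 f g n = f n.
Proof. intros H; unfold join; rewrite (proj2 (Nat.ltb_lt _ _) H); reflexivity. Qed.

Lemma join_ge {A} n0 (f g : nat -> A) n : join n0 f g (n0 + n) = g n.
Proof.
  unfold join; rewrite (proj2 (Nat.ltb_ge _ _)) by lia; f_equal; lia.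
Qed.

Lemma run_join_lt F n0 X Y tau tau' p n : n <= n0 ->
  run F (join n0 X Y) (join n0 tau tau') p n = run F X tau p n.
Proof.
  induction n as [|n IH]; intros Hn; [reflexivity|]; simpl.
  rewrite IH, !join_lt by lia; reflexivity.
Qed.

Lemma run_join_ge F n0 X Y tau tau' p n :
  run F (join n0 X Y) (join n0 tau tau') p (n0 + n) =
  run F Y tau' (run F X tau p n0) n.
Proof.
  induction n as [|n IH].
  - rewrite Nat.add_0_r; exact (run_join_lt F n0 X Y tau tau' p n0 (le_n _)).
  - rewrite Nat.add_succ_r; simpl; rewrite IH, !join_ge; reflexivity.
Qed.

(** After the prefix the engine behaves as if started at the hypothesis reached, while the data of
    the prefix still count towards the trace. *)
Lemma cegis_run_join L F p i n0 X Y tau tau' :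
  cegis_identifies L F p i ->
  (forall n, n < n0 ->
     check_ok (L i) (L (run F X tau p n)) (X n (run F X tau p n))) ->
  is_trace (L i) (join n0 tau tau') ->
  (forall n, check_ok (L i) (L (run F Y tau' (run F X tau p n0) n))
               (Y n (run F Y tau' (run F X tau p n0) n))) ->
  converges_to (run F Y tau' (run F X tau p n0)) i.
Proof.
  intros Hid HX Htau HY.
  destruct (cegis_run L F p i (join n0 X Y) (join n0 tau tau') Hid Htau) as [N HN].
  - intros n; destruct (Nat.lt_ge_cases n n0) as [Hn|Hn].
    + rewrite run_join_lt, join_lt by lia; auto.
    + replace n with (n0 + (n - n0)) by lia; rewrite run_join_ge, join_ge; auto.
  - exists N; intros n Hn; rewrite <- run_join_ge; apply HN; lia.
Qed.

Lemma first_hit (f : nat -> bool) N :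
  f N = true -> exists n, f n = true /\ forall m, m < n -> f m = false.
Proof.
  induction N as [N IH] using lt_wf_ind; intros HN.
  destruct (exb N f) eqn:E.
  - apply exb_true in E; destruct E as [m [Hm E]]; exact (IH m Hm E).
  - exists N; split; [exact HN|]; intros m Hm; apply not_true_is_false; intros Em.
    apply not_true_iff_false in E; apply E, exb_true; eauto.
Qed.

Lemma prefix_bound (f : nat -> nat) N : exists d, forall n, n < N -> f n < d.
Proof.
  induction N as [|N [d IH]]; [exists 0; lia|].
  exists (d + S (f N)); intros n Hn; destruct (Nat.eq_dec n N) as [->|]; [lia|].
  specialize (IH n ltac:(lia)); lia.
Qed.

(* A counterexample to hypothesis [h] that tells nothing but [h] itself. *)
Definition junk (h : nat) : nat :=
  if pi2 h =? 0 then 4 * pi1 h + 2 else 4 * label h + 3.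

Definition answer (j : nat) (c : option nat) (h : nat) : option nat :=
  if h =? j then c else Some (junk h).

Lemma recursive1_promoted : recursive1 (fun h => Nat.b2n (promoted h)).
Proof. apply recursive1_intro; unfold promoted, par_e; rec. Qed.
#[global] Hint Resolve recursive1_promoted : recdb.

Lemma recursive1_junk : recursive1 junk.
Proof. apply recursive1_intro; unfold junk; rec. Qed.
#[global] Hint Resolve recursive1_junk : recdb.

Lemma junk_in h : fam h (junk h) = true.
Proof.
  rewrite <- (cpair_pi h) at 1; unfold junk.
  destruct (Nat.eqb_spec (pi2 h) 0) as [E|E].
  - rewrite fam_q, E; apply Nat.eqb_refl.
  - rewrite fam_p, cpair_pi, Nat.eqb_refl; destruct (pi2 h); [contradiction | reflexivity].
Qed.

(* The hypotheses whose label is that of [cpair z 1]. *)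
Definition hitb (z h : nat) : bool :=
  (h =? cpair z 1) || (pi1 h =? z) && promoted h.

Lemma recursive2_hitb : recursive2 (fun z h => Nat.b2n (hitb z h)).
Proof. apply recursive2_intro; unfold hitb; rec. Qed.
#[global] Hint Resolve recursive2_hitb : recdb.

(** Thus a large padding [d] in [code_z] moves all hits beyond the finitely many hypotheses of an
    initial run. *)
Lemma hitb_ge z h : hitb z h = true -> z <= h.
Proof.
  unfold hitb; intros H; pose proof (cpair_ge z 1); pose proof (cpair_ge (pi1 h) (pi2 h)) as Hg.
  rewrite cpair_pi in Hg; apply orb_true_iff in H; rewrite andb_true_iff, !Nat.eqb_eq in H.
  destruct H as [H|[H _]]; lia.
Qed.

Lemma label_hitb z h : label h = cpair z 1 -> hitb z h = true.
Proof.
  unfold label, hitb; destruct (promoted h); intros H.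
  - apply cpair_inj in H; destruct H as [-> _]; rewrite Nat.eqb_refl; apply orb_true_r.
  - rewrite H, Nat.eqb_refl; reflexivity.
Qed.

Lemma junk_ok_J q h : h <> cpair q 0 -> check_ok (fam (cpair q 0)) (fam h) (Some (junk h)).
Proof.
  intros NE; split; [apply junk_in|]; unfold junk.
  destruct (Nat.eqb_spec (pi2 h) 0) as [E|E].
  - rewrite fam_q; simpl; apply Nat.eqb_neq; intros E1; apply NE.
    rewrite <- (cpair_pi h); congruence.
  - rewrite fam_p; reflexivity.
Qed.

(** Covers the base language and the promoted one together, so the same answers are legal for both
    targets. *)
Lemma junk_ok z m h :
  label (cpair z (S m)) = cpair z 1 -> h <> cpair (par_q z) 0 -> hitb z h = false ->
  check_ok (fam (cpair z (S m))) (fam h) (Some (junk h)).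
Proof.
  intros Hl NE Hh; split; [apply junk_in|]; unfold junk.
  destruct (Nat.eqb_spec (pi2 h) 0) as [E|E].
  - rewrite fam_q; simpl; apply Nat.eqb_neq; intros E1; apply NE.
    rewrite <- (cpair_pi h); congruence.
  - rewrite fam_p, Hl; simpl; apply Nat.eqb_neq; intros E1.
    rewrite (label_hitb _ _ E1) in Hh; discriminate.
Qed.

Lemma base_subset z m x : fam (cpair z 1) x = true ->
  label (cpair z (S m)) = cpair z 1 -> fam (cpair z (S m)) x = true.
Proof.
  intros H Hl; destruct (elem_cases x) as [y [->|[->|[->| ->]]]].
  - rewrite fam_a in *; simpl in *; apply Nat.ltb_lt in H; apply Nat.ltb_lt.
    destruct m; simpl; lia.
  - apply fam_e.
  - rewrite fam_q in *; exact H.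
  - rewrite fam_p in *; rewrite Hl; rewrite label_base in H; exact H.
Qed.

Definition code_z (q k r d e : nat) : nat := cpair q (cpair k (cpair r (cpair e d))).

Lemma par_q_code q k r d e : par_q (code_z q k r d e) = q.
Proof. apply pi1_cpair. Qed.

Lemma par_k_code q k r d e : par_k (code_z q k r d e) = k.
Proof. unfold par_k, code_z; rewrite pi2_cpair; apply pi1_cpair. Qed.

Lemma par_r_code q k r d e : par_r (code_z q k r d e) = r.
Proof. unfold par_r, code_z; rewrite !pi2_cpair; apply pi1_cpair. Qed.

Lemma par_e_code q k r d e : par_e (code_z q k r d e) = e.
Proof. unfold par_e, code_z; rewrite !pi2_cpair; apply pi1_cpair. Qed.

Lemma code_z_ge q k r d e : d <= code_z q k r d e.
Proof.
  unfold code_z; pose proof (cpair_ge q (cpair k (cpair r (cpair e d)))).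
  pose proof (cpair_ge k (cpair r (cpair e d))); pose proof (cpair_ge r (cpair e d)).
  pose proof (cpair_ge e d); lia.
Qed.

(** Legal verifiers for the two targets differ only at hits; up to the first hit one computable
    verifier can replace them. *)
Lemma run_agree F z Y Y' tau p n :
  (forall h, hitb z h = false -> Y h = Y' h) ->
  (forall m, m < n -> hitb z (run F (fun _ => Y') tau p m) = false) ->
  run F (fun _ => Y) tau p n = run F (fun _ => Y') tau p n.
Proof.
  intros HY; induction n as [|n IH]; intros H; [reflexivity|]; simpl.
  rewrite IH by (intros m Hm; apply H; lia); rewrite HY by (apply H; lia); reflexivity.
Qed.

Lemma fam_J_below q n y : fam (cpair q 0) n = true ->
  n < 4 * y -> forall z m, par_q z = q -> y <= par_k z + (if m =? 0 then 0 else S (par_r z)) ->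
  fam (cpair z (S m)) n = true.
Proof.
  intros H Hn z m Hq Hy; destruct (elem_cases n) as [x [->|[->|[->| ->]]]].
  - rewrite fam_a; destruct m; simpl in *; apply Nat.ltb_lt; lia.
  - apply fam_e.
  - rewrite fam_q in *; simpl in *; rewrite Hq; exact H.
  - rewrite fam_p in H; discriminate.
Qed.

(** * Deciding the existence of certificates with a CEGIS engine *)

Section CEGIS.

Variables (F : nat -> option nat -> option nat -> nat) (p0 : nat).
Hypothesis F_rec : engine_recursive F.
Hypothesis F_id : forall i, cegis_identifies fam F p0 i.

(** With this [q] the engine does not start at [J], so it reads at least one datum before reaching
    it. *)
Let q := S p0.
Let J := cpair q 0.

Lemma J_not_initial : p0 <> J.
Proof. unfold J, q; pose proof (cpair_ge (S p0) 0); lia. Qed.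

Lemma J_first_hit tau : is_trace (fam J) tau ->
  exists n, run F (fun _ => answer J None) tau p0 n = J /\
    forall m, m < n -> run F (fun _ => answer J None) tau p0 m <> J.
Proof.
  intros Htau.
  destruct (cegis_run fam F p0 J (fun _ => answer J None) tau (F_id J) Htau) as [N HN].
  - intros n; set (h := run _ _ _ _ _); unfold answer.
    destruct (Nat.eqb_spec h J) as [->|NE]; [apply check_ok_refl | exact (junk_ok_J q h NE)].
  - destruct (first_hit (fun n => run F (fun _ => answer J None) tau p0 n =? J) N)
      as [n [H1 H2]]; [apply Nat.eqb_eq, HN; lia|].
    exists n; split; [apply Nat.eqb_eq, H1 | intros m Hm; apply Nat.eqb_neq, H2, Hm].
Qed.

Definition delayed_text (k : nat) (n : nat) : option nat :=
  match n with 0 => Some (4 * k + 0) | S n => text (fam J) n end.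

Lemma delayed_text_trace k : is_trace (fam J) (delayed_text k).
Proof.
  intros x; split.
  - intros Hx; exists (S x); simpl; unfold text; rewrite Hx; reflexivity.
  - intros [[|n] Hn].
    + replace x with (4 * k + 0) by (unfold delayed_text in Hn; congruence).
      unfold J; rewrite fam_a; reflexivity.
    + exact (proj2 (text_elem _ _ _ Hn)).
Qed.

Lemma recursive2_run c (g : nat -> nat) : recursive1 g ->
  recursive2 (fun e => run F (fun _ => answer J (Some c)) (text (fam (g e))) J).
Proof.
  intros Hg; destruct F_rec as [cF HF].
  pose (dec x := match x with 0 => None | S n => Some n end).
  pose (Fn p x y := F p (dec x) (dec y)).
  assert (HFn : recursive3 Fn).
  { exists cF; intros p x y; specialize (HF p (dec x) (dec y)).
    destruct x, y; exact HF. }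
  apply recursive2_intro.
  apply Rec_ext with (fun v => natrec J (fun m h =>
    Fn h (if fam (g (nth 0 v 0)) m then S m else 0)
         (if h =? J then S c else S (junk h))) (nth 1 v 0)).
  - intros v _; induction (nth 1 v 0) as [|m IH]; simpl; [reflexivity|].
    rewrite IH; unfold Fn, text, answer.
    destruct (fam (g (nth 0 v 0)) m), (_ =? J); reflexivity.
  - rec.
Qed.

Lemma cegis_decides_cert : exists d : nat -> bool,
  recursive1 (fun e => Nat.b2n (d e)) /\
  forall e, d e = true <-> exists s, cert e s = true.
Proof.
  (* Two ways to [J]: by [k0] data that do not include [4 * k0], and by [n1] data that begin with
     it. *)
  destruct (J_first_hit (text (fam J)) (text_trace _)) as [k0 [Hk0 Hk0']].
  destruct (J_first_hit (delayed_text k0) (delayed_text_trace k0)) as [n1 [Hn1 Hn1']].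
  set (run0 := run F (fun _ => answer J None) (text (fam J)) p0) in *.
  set (run1 := run F (fun _ => answer J None) (delayed_text k0) p0) in *.
  assert (Hn1pos : 0 < n1).
  { destruct n1; [|lia]; elim J_not_initial; exact Hn1. }
  (* [(n1 + 2) / 4] is a quarter of [n1 - 1] rounded up. The second run has shown the elements of
     [J] below [n1 - 1], hence each [4 * n] with [k0 <= n < k1] and none with [k1 <= n]; with this
     [r] the former are exactly what promotion adds. *)
  set (k1 := Nat.max (k0 + 1) ((n1 + 2) / 4)).
  set (r := k1 - k0 - 1).
  destruct (prefix_bound run0 k0) as [d0 Hd0].
  destruct (prefix_bound run1 n1) as [d1 Hd1].
  set (z := code_z q k0 r (d0 + d1)).
  (* [4 * k1] is in [J] but in neither target, so the answer at [J] does not distinguish them. *)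
  set (Y := answer J (Some (4 * k1 + 0))).
  set (sim := fun e => run F (fun _ => Y) (text (fam (cpair (z e) 1))) J).
  assert (Hr : k0 + S r = k1) by (unfold r, k1; lia).
  assert (Hq : forall e, par_q (z e) = q) by (intros; apply par_q_code).
  assert (Hk : forall e, par_k (z e) = k0) by (intros; apply par_k_code).
  assert (Hrr : forall e, par_r (z e) = r) by (intros; apply par_r_code).
  assert (He : forall e, par_e (z e) = e) by (intros; apply par_e_code).
  assert (Hlow : forall e h, h < d0 + d1 -> hitb (z e) h = false).
  { intros e h Hh; apply not_true_is_false; intros H; apply hitb_ge in H.
    pose proof (code_z_ge q k0 r (d0 + d1) e); unfold z in H; lia. }
  assert (Hfirst : forall e m h, label (cpair (z e) (S m)) = cpair (z e) 1 ->
    h <> J -> h < d0 + d1 ->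
    check_ok (fam (cpair (z e) (S m))) (fam h) (answer J None h)).
  { intros e m h Hl NE Hh; unfold answer; rewrite (proj2 (Nat.eqb_neq _ _) NE).
    apply junk_ok; [exact Hl | rewrite Hq; exact NE | apply Hlow, Hh]. }
  assert (HY : forall e m h, label (cpair (z e) (S m)) = cpair (z e) 1 ->
    hitb (z e) h = false ->
    check_ok (fam (cpair (z e) (S m))) (fam h) (Y h)).
  { intros e m h Hl Hh; unfold Y, answer; destruct (Nat.eqb_spec h J) as [->|NE].
    - split; unfold J; rewrite fam_a; [reflexivity|].
      rewrite Hk, Hrr; destruct m; simpl; apply Nat.ltb_ge; lia.
    - apply junk_ok; [exact Hl | rewrite Hq; exact NE | exact Hh]. }
  (* [Y1] extends [Y] to hits legally for the target [B]: promoted hypotheses contain [4 * k0] and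
     [B] does not. Convergence to [B] forces a hit, and before the first one [Y1] and [Y] agree. *)
  assert (Hhit : forall e, exists n, hitb (z e) (sim e n) = true /\
    forall m, m < n -> hitb (z e) (sim e m) = false).
  { intros e; set (B := cpair (z e) 1).
    set (Y1 := fun h => if h =? B then None
                        else if hitb (z e) h then Some (4 * k0 + 0) else Y h).
    destruct (cegis_run_join fam F p0 B k0 (fun _ => answer J None) (fun _ => Y1)
      (text (fam J)) (text (fam B)) (F_id B)) as [N HN].
    - intros n Hn; apply Hfirst; [apply label_base | apply Hk0', Hn |].
      specialize (Hd0 n Hn); unfold run0 in Hd0; lia.
    - intros x; split.
      + intros Hx; exists (k0 + x); rewrite join_ge; unfold text; rewrite Hx; reflexivity.
      + intros [n Hn]; destruct (Nat.lt_ge_cases n k0) as [L|L].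
        * rewrite join_lt in Hn by exact L; apply text_elem in Hn; destruct Hn as [-> Hn].
          apply (fam_J_below q n k0 Hn ltac:(lia)); [apply Hq | rewrite Hk; lia].
        * replace n with (k0 + (n - k0)) in Hn by lia; rewrite join_ge in Hn.
          exact (proj2 (text_elem _ _ _ Hn)).
    - intros n; set (h := run _ _ _ _ _); unfold Y1.
      destruct (Nat.eqb_spec h B) as [->|NE]; [apply check_ok_refl|].
      destruct (hitb (z e) h) eqn:Hh; [|apply HY; [apply label_base | exact Hh]].
      unfold hitb in Hh; fold B in Hh; rewrite (proj2 (Nat.eqb_neq _ _) NE) in Hh.
      apply andb_true_iff in Hh; destruct Hh as [Hz Hp]; apply Nat.eqb_eq in Hz.
      unfold promoted in Hp; apply andb_true_iff in Hp; destruct Hp as [Hp _].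
      apply Nat.leb_le in Hp; split; [|unfold B]; [rewrite <- (cpair_pi h)|];
        rewrite fam_a; [rewrite Hz|]; rewrite Hk.
      + destruct (pi2 h) as [|[|s]]; simpl; [lia | lia | apply Nat.ltb_lt; lia].
      + simpl; apply Nat.ltb_ge; lia.
    - specialize (HN N (le_n N)); fold run0 in HN; rewrite Hk0 in HN.
      destruct (exb N (fun m => hitb (z e) (sim e m))) eqn:E.
      + apply exb_true in E; destruct E as [m [_ E]]; exact (first_hit _ m E).
      + apply (first_hit _ N); unfold sim.
        rewrite <- (run_agree F (z e) Y1 Y); fold B.
        * rewrite HN; unfold hitb; fold B; rewrite Nat.eqb_refl; reflexivity.
        * intros h Hh; unfold Y1; rewrite Hh; destruct (Nat.eqb_spec h B) as [->|]; [|reflexivity].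
          unfold hitb in Hh; fold B in Hh; rewrite Nat.eqb_refl in Hh; discriminate.
        * intros m Hm; apply not_true_is_false; intros Em.
          apply not_true_iff_false in E; apply E, exb_true; eauto. }
  destruct (functional_choice _ Hhit) as [f Hf].
  (* The first hit gives the decision. [f], obtained by choice, is recursive because it is the
     result of an unbounded search that always stops. *)
  exists (fun e => promoted (sim e (f e))); split.
  - assert (Hz : recursive1 z) by (apply recursive1_intro; unfold z, code_z; rec).
    assert (Hsim : recursive2 sim)
      by (apply recursive2_run, recursive1_intro; rec).
    assert (Hfr : recursive1 f).
    { apply recursive1_intro.
      apply Rec_min with (fun v n => hitb (z (nth 0 v 0)) (sim (nth 0 v 0) n)).
      - rec.
      - intros v _; apply Hf.
      - intros v m _; apply Hf. }
    apply recursive1_intro; rec.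
  - intros e; destruct (Hf e) as [Hf1 Hf2]; split.
    + intros Hp; unfold hitb in Hf1; apply orb_true_iff in Hf1; destruct Hf1 as [E|E].
      * apply Nat.eqb_eq in E; rewrite E, promoted_base in Hp; discriminate.
      * apply andb_true_iff in E; destruct E as [E _]; apply Nat.eqb_eq in E.
        unfold promoted in Hp; rewrite E, He in Hp; apply andb_true_iff in Hp.
        destruct Hp as [_ Hp]; apply firstb_spec in Hp; destruct Hp; eauto.
    + intros [s0 Hs0]; destruct (first_hit (cert e) s0 Hs0) as [s Hs].
      set (B := cpair (z e) 1); set (i := cpair (z e) (S (S s))).
      assert (Hfs : firstb (par_e (z e)) s = true) by (rewrite He; apply firstb_spec, Hs).
      assert (Hl : label i = B).
      { unfold label, i; rewrite promoted_query, Hfs, pi1_cpair; reflexivity. }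
      unfold hitb in Hf1; apply orb_true_iff in Hf1; destruct Hf1 as [E|E];
        [|apply andb_true_iff in E; apply E].
      exfalso; apply Nat.eqb_eq in E; fold B in E.
      (* Suppose the first hit is [B] although [i] is promoted. For the target [i] the answer [None]
         is legal at every hit: [B] is a subset of [i], and by uniqueness of the least certificate
         the only other hit is [i]. *)
      set (Y2 := fun h => if hitb (z e) h then None else Y h).
      destruct (cegis_run_join fam F p0 i n1 (fun _ => answer J None) (fun _ => Y2)
        (delayed_text k0) (text (fam B)) (F_id i)) as [N HN].
      * intros n Hn; apply Hfirst; [exact Hl | apply Hn1', Hn |].
        specialize (Hd1 n Hn); unfold run1 in Hd1; lia.
      * intros x; split.
        -- intros Hx; destruct (fam B x) eqn:Ex.
           { exists (n1 + x); rewrite join_ge; unfold text; rewrite Ex; reflexivity. }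
           destruct (elem_cases x) as [y [->|[->|[->| ->]]]].
           ++ unfold i in Hx; unfold B in Ex; rewrite fam_a in Hx, Ex; simpl in Hx, Ex.
              rewrite Hk, Hrr in Hx; rewrite Hk in Ex; apply Nat.ltb_lt in Hx; apply Nat.ltb_ge in Ex.
              destruct (Nat.eq_dec y k0) as [->|].
              ** exists 0; rewrite join_lt by exact Hn1pos; reflexivity.
              ** pose proof (Nat.div_mod_eq (n1 + 2) 4); pose proof (Nat.mod_upper_bound (n1 + 2) 4 ltac:(lia)).
                 exists (S (4 * y + 0)); rewrite join_lt by (unfold k1 in *; lia).
                 unfold delayed_text, text, J; rewrite fam_a; reflexivity.
           ++ rewrite fam_e in Ex; discriminate.
           ++ unfold i in Hx; unfold B in Ex; rewrite fam_q in Hx, Ex; simpl in Hx, Ex; congruence.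
           ++ unfold i in Hx; unfold B in Ex; rewrite fam_p in Hx, Ex.
              fold i in Hx; rewrite Hl in Hx; rewrite label_base in Ex; simpl in Hx, Ex; fold B in Ex; congruence.
        -- intros [n Hn]; destruct (Nat.lt_ge_cases n n1) as [L|L].
           ++ rewrite join_lt in Hn by exact L; destruct n as [|n].
              ** replace x with (4 * k0 + 0) by (unfold delayed_text in Hn; congruence).
                 unfold i; rewrite fam_a, Hk; simpl; apply Nat.ltb_lt; lia.
              ** apply text_elem in Hn; destruct Hn as [-> Hn].
                 apply (fam_J_below q n k1 Hn); [|apply Hq | simpl; rewrite Hk, Hrr; lia].
                 pose proof (Nat.div_mod_eq (n1 + 2) 4); pose proof (Nat.mod_upper_bound (n1 + 2) 4 ltac:(lia)).
                 unfold k1; lia.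
           ++ replace n with (n1 + (n - n1)) in Hn by lia; rewrite join_ge in Hn.
              apply base_subset; [exact (proj2 (text_elem _ _ _ Hn)) | exact Hl].
      * intros n; set (h := run _ _ _ _ _); unfold Y2.
        destruct (hitb (z e) h) eqn:Hh; [|apply HY; [exact Hl | exact Hh]].
        unfold hitb in Hh; apply orb_true_iff in Hh; destruct Hh as [Hh|Hh].
        -- apply Nat.eqb_eq in Hh; rewrite Hh; intros x Hx; apply base_subset; assumption.
        -- apply andb_true_iff in Hh; destruct Hh as [Hz Hp]; apply Nat.eqb_eq in Hz.
           replace h with i; [apply check_ok_refl|].
           unfold promoted in Hp; apply andb_true_iff in Hp; destruct Hp as [H2 Hp].
           apply Nat.leb_le in H2; rewrite Hz in Hp.
           unfold i; rewrite (firstb_unique _ _ _ Hfs Hp), <- Hz.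
           replace (S (S (pi2 h - 2))) with (pi2 h) by lia; apply cpair_pi.
      * fold run1 in HN; rewrite Hn1 in HN.
        (* The run follows the simulation to [B], and by [cegis_lock] the engine stays there on
           [None] and data of [B], against convergence to [i]. *)
        assert (Hstay : forall m, run F (fun _ => Y2) (text (fam B)) J (f e + m) = B).
        { induction m as [|m IH].
          - rewrite Nat.add_0_r, (run_agree F (z e) Y2 Y); [exact E | | exact Hf2].
            intros h Hh; unfold Y2; rewrite Hh; reflexivity.
          - rewrite Nat.add_succ_r; simpl; rewrite IH.
            replace (Y2 B) with (@None nat).
            + apply (cegis_lock fam F p0 B); [apply F_id|].
              intros x Hx; exact (proj2 (text_elem _ _ _ Hx)).
            + unfold Y2, hitb; fold B; rewrite Nat.eqb_refl; reflexivity. }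
        specialize (HN (f e + N) ltac:(lia)); rewrite Hstay in HN.
        apply cpair_inj in HN; lia.
Qed.

End CEGIS.

Lemma fam_not_in_CEGIS : ~ in_CEGIS fam.
Proof.
  intros [F [p0 [F_rec F_id]]].
  destruct (cegis_decides_cert F p0 F_rec F_id) as [d [Hd Hspec]].
  exact (cert_undecidable d Hd Hspec).
Qed.

Theorem lemma2 :
  exists L : nat -> lang, indexed_family L /\ in_HCEGIS L /\ ~ in_CEGIS L.
Proof.
  exists fam; split; [exact fam_indexed|].
  split; [exact fam_in_HCEGIS | exact fam_not_in_CEGIS].
Qed.
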